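(* Let $k\geq1$ and let $P_1,\dots,P_k\in\mathbb{Z}[\mathrm{n}]$ be polynomials, not all constant. Let $0<p_1,\dots,p_k,p\leq\infty$ and $0<r\leq2$. Let $\mathbb{I}\subseteq\mathbb{Z}_+$ be an infinite set. Then there does not exist any constant $C>0$ for which one has the estimate $$\big\|(A_{N,X}(f_1,\dots,f_k))_{N\in\mathbb{I}}\big\|_{L^p(X;V^r)}\leq C\,\|f_1\|_{L^{p_1}(X)}\cdots\|f_k\|_{L^{p_k}(X)}$$ for all measure-preserving systems $X=(X,\mu,T)$ of total mass one and all $f_1\in L^{p_1}(X),\dots,f_k\in L^{p_k}(X)$, where $$A_{N,X}(f_1,\dots,f_k)(x)=\frac1N\sum_{n=1}^N f_1(T^{P_1(n)}x)\cdots f_k(T^{P_k(n)}x).$$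
   Context: A measure-preserving system $(X,\mu,T)$ is a $\sigma$-finite measure space $(X,\mu)$ with an invertible bimeasurable map $T:X\to X$ such that $\mu(T(E))=\mu(E)$ for all measurable $E$; total mass one means $\mu(X)=1$. $\mathbb{Z}_+=\{1,2,\dots\}$. For scalars $(a_t)_{t\in\mathbb{I}}$ indexed by a totally ordered set and $0<r<\infty$, the $r$-variation is $$\|(a_t)_{t\in\mathbb I}\|_{V^r}=\sup_{J\in\mathbb{Z}_+}\ \sup_{t_0\le\dots\le t_J,\ t_j\in\mathbb I}\Big(\sum_{j=0}^{J-1}|a_{t_{j+1}}-a_{t_j}|^r\Big)^{1/r},$$ and $\|(F_t)_{t\in\mathbb I}\|_{L^p(X;V^r)}$ is the $L^p(X)$ (quasi)norm of $x\mapsto\|(F_t(x))_{t\in\mathbb I}\|_{V^r}$. *)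

(* Defs.v *)
From HB Require Import structures.
From mathcomp Require Import all_boot all_order all_algebra.
From mathcomp Require Import all_classical all_reals all_analysis.
From mathcomp Require Import complex.

Set Implicit Arguments.
Unset Strict Implicit.
Unset Printing Implicit Defensive.

Import Order.TTheory GRing.Theory Num.Theory.
Import numFieldNormedType.Exports.

Local Open Scope classical_set_scope.
Local Open Scope ring_scope.

(* [S] is the inverse of [T]. The measure is not required to be sigma-finite
   here because it is only ever used with total mass one. *)
Definition mp_system (R : realType) (d : measure_display)
    (X : measurableType d) (mu : {measure set X -> \bar R}) (T S : X -> X) :
    Prop :=
  [/\ cancel T S, cancel S T, measurable_fun setT T, measurable_fun setT S
    & forall E : set X, measurable E -> mu (T @` E) = mu E].

(* [T ^ m] for an integer [m], where [S] is the inverse of [T];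
   recall that [Negz n] is [- n.+1]. *)
Definition iterz (X : Type) (T S : X -> X) (m : int) : X -> X :=
  match m with
  | Posz n => iter n T
  | Negz n => iter n.+1 S
  end.

Definition cmeasurable (R : realType) (d : measure_display)
    (X : measurableType d) (f : X -> R[i]) : Prop :=
  measurable_fun setT (fun x => complex.Re (f x)) /\
  measurable_fun setT (fun x => complex.Im (f x)).

(* A quasinorm only, when [p < 1]. *)
Definition cLnorm (R : realType) (d : measure_display) (X : measurableType d)
    (mu : {measure set X -> \bar R}) (p : \bar R) (f : X -> R[i]) : \bar R :=
  Lnorm mu p (fun x => (ComplexField.Normc.normc (f x))%:E).

Definition in_cLp (R : realType) (d : measure_display) (X : measurableType d)
    (mu : {measure set X -> \bar R}) (p : \bar R) (f : X -> R[i]) : Prop :=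
  cmeasurable f /\ (cLnorm mu p f < +oo)%E.

(* Only the values of [a] on [D] matter; the supremum may be [+oo]. *)
Definition variation (R : realType) (d : Order.disp_t) (I : orderType d)
    (D : set I) (r : R) (a : I -> R[i]) : \bar R :=
  ereal_sup [set v : \bar R | exists (J : nat) (t : nat -> I),
    [/\ (0 < J)%N,
        (forall j, (j <= J)%N -> D (t j)),
        (forall j, (j < J)%N -> (t j <= t j.+1)%O)
      & v = ((\sum_(0 <= j < J)
                ComplexField.Normc.normc (a (t j.+1) - a (t j)) `^ r)
               `^ r^-1)%:E]].

Definition LpVr (R : realType) (d : measure_display) (X : measurableType d)
    (mu : {measure set X -> \bar R}) (p : \bar R) (r : R)
    (d' : Order.disp_t) (I : orderType d') (D : set I)
    (F : I -> X -> R[i]) : \bar R :=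
  Lnorm mu p (fun x => variation D r (fun t => F t x)).

Definition poly_average (R : realType) (X : Type) (T S : X -> X) (k : nat)
    (P : 'I_k -> {poly int}) (f : 'I_k -> X -> R[i]) (N : nat) (x : X) :
    R[i] :=
  N%:R^-1 * \sum_(1 <= n < N.+1)
    \prod_(i < k) f i (iterz T S (P i).[n%:Z] x).

(* Main.v *)
Require Import Defs.
From HB Require Import structures.
From mathcomp Require Import all_boot all_order all_algebra.
From mathcomp Require Import all_classical all_reals all_analysis.
From mathcomp Require Import complex.
From mathcomp Require Import measurable_realfun ess_sup_inf.
From mathcomp Require Import ring lra zify.

Set Implicit Arguments.
Unset Strict Implicit.
Unset Printing Implicit Defensive.

Import Order.TTheory GRing.Theory Num.Theory.
Import numFieldNormedType.Exports.

Local Open Scope classical_set_scope.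
Local Open Scope ring_scope.

(** The functions [f_i] may all be taken equal to 1 except for one whose
    polynomial [P] is not constant. It then suffices to find, for every
    constant, a finite cyclic group, rotated by 1, and a function bounded by 2
    whose averages along [P] have a variation at least that constant on a set
    of measure at least 1/4.

    The group is Z/Q with Q = q_0 ... q_{n-1} a product of distinct primes, and
    the function is the Riesz product of the factors 1 + i a e_j(x), where
    e_j(x) is 1 or -1 according to the half of Z/q_j that contains x. The
    primes are interleaved with times of I, N_0 << q_0 << N_1 << q_1 << ...
    For most x the average at time N_j treats the two kinds of factors in
    opposite ways. If i >= j then q_i is so large that x + P(m) stays in the
    same half for all m <= N_j, and the factor is constant along the orbit. If
    i < j then N_j covers many periods of Q_j = q_0 ... q_{j-1}: by the Chinese
    remainder theorem these factors are averaged independently, and each mean is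
    close to 1 because the values of P are equidistributed modulo q_i
    ([weyl], [most_typical]). So the average is close to the product M_j of the
    factors with i >= j ([avg_close]), while the signs e_j(x) behave like
    independent fair coins ([joint_law]): the averages follow a reversed
    martingale.

    With a of the order of 1 / sqrt n the martingale is bounded, and its
    increment between s and t is at least a |S| / 2, where S is the sum of the
    signs in between, as long as a |S| <= 1/2 ([riesz_prod_sub1], [avg_jump]).
    The variation is therefore governed by the sums of S^2 over partitions of
    {0, ..., n} chosen after the path has been seen, divided by n. For a
    partition fixed in advance such a sum has mean n; but just as a Brownian
    path has infinite quadratic variation when the partition may depend on it,
    with probability at least 1/2 some partition yields at least K^2 n / 2
    ([most_walks_split]). Indeed, view {0, ..., n} as a tree of blocks and
    select a block of length l when its increment is at least K sqrt l. At each
    scale this happens with a probability bounded below in terms of K only, and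
    nearly independently of the smaller scales, so that with many scales almost
    every step lies in a selected block. The maximal selected blocks are
    disjoint and contribute at least K^2 times their length. The exponent 2 is
    critical because the squares of the increments scale like the lengths;
    exponents r <= 2 follow, since the lower bounds used for the increments are
    at most 1. *)

(** * Random signs *)

Section Signs.
Variable R : realType.
Implicit Types (m n : nat) (u v : seq bool) (phi psi : seq bool -> R).

(** Expectation over n independent fair signs. Sequences rather than tuples
    make the independence of consecutive blocks an identity between iterated
    means, [mean_cat]. *)
Fixpoint mean n phi : R :=
  if n is n'.+1 then
    (mean n' (fun u => phi (true :: u)) + mean n' (fun u => phi (false :: u))) / 2
  else phi [::].

Definition sign (b : bool) : R := if b then 1 else -1.
Definition walk u : R := \sum_(b <- u) sign b.

Lemma walk_nil : walk [::] = 0. Proof. by rewrite /walk big_nil. Qed.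

Lemma walk_cons b u : walk (b :: u) = sign b + walk u.
Proof. by rewrite /walk big_cons. Qed.

Lemma walk_cat u v : walk (u ++ v) = walk u + walk v.
Proof. by rewrite /walk big_cat. Qed.

Lemma walk_negb u : walk (map negb u) = - walk u.
Proof.
elim: u => [|b u IH]; first by rewrite /= walk_nil oppr0.
by rewrite /= !walk_cons IH opprD; case: b; rewrite /= ?opprK.
Qed.

Lemma le_mean n phi psi :
  (forall u, size u = n -> phi u <= psi u) -> mean n phi <= mean n psi.
Proof.
elim: n phi psi => [|n IH] phi psi le_pp /=; first exact: le_pp.
by rewrite ler_pM2r ?invr_gt0 ?ltr0n// lerD// IH// => u su; apply: le_pp; rewrite /= su.
Qed.

Lemma eq_mean n phi psi :
  (forall u, size u = n -> phi u = psi u) -> mean n phi = mean n psi.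
Proof.
by move=> e; apply/eqP; rewrite eq_le !le_mean// => u /e ->.
Qed.

Lemma mean_cst n (c : R) : mean n (fun=> c) = c.
Proof. by elim: n => //= n ->; lra. Qed.

Lemma meanD n phi psi :
  mean n (fun u => phi u + psi u) = mean n phi + mean n psi.
Proof. by elim: n phi psi => //= n IH phi psi; rewrite !IH; lra. Qed.

Lemma meanZ n (c : R) phi : mean n (fun u => c * phi u) = c * mean n phi.
Proof. by elim: n phi => //= n IH phi; rewrite !IH; lra. Qed.

Lemma mean_sum n (J : Type) (r : seq J) (phi : J -> seq bool -> R) :
  mean n (fun u => \sum_(j <- r) phi j u) = \sum_(j <- r) mean n (phi j).
Proof.
elim: r => [|j r IH].
  by rewrite big_nil -[RHS](mean_cst n); apply: eq_mean => u _; rewrite big_nil.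
rewrite big_cons -IH -meanD; apply: eq_mean => u _; exact: big_cons.
Qed.

Lemma mean_ge0 n phi : (forall u, size u = n -> 0 <= phi u) -> 0 <= mean n phi.
Proof. by move=> h; rewrite -(mean_cst n 0) le_mean. Qed.

Lemma mean_cat m n phi :
  mean (m + n) phi = mean m (fun u => mean n (fun v => phi (u ++ v))).
Proof. by elim: m phi => //= m IH phi; rewrite !IH. Qed.

Lemma mean_rcons n phi :
  mean n.+1 phi =
  (mean n (fun u => phi (rcons u true)) + mean n (fun u => phi (rcons u false))) / 2.
Proof.
rewrite -addn1 mean_cat /= -meanD [RHS]mulrC -meanZ.
by apply: eq_mean => u _; rewrite !cats1 mulrC.
Qed.

Lemma mean_exchange m n (phi : seq bool -> seq bool -> R) :
  mean m (fun u => mean n (phi u)) = mean n (fun v => mean m (phi^~ v)).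
Proof.
elim: m phi => //= m IH phi; rewrite !IH -meanD [LHS]mulrC -meanZ.
by apply: eq_mean => u _; rewrite mulrC.
Qed.

Lemma mean_negb n phi : mean n (fun u => phi (map negb u)) = mean n phi.
Proof.
elim: n phi => //= n IH phi.
by rewrite (IH (fun u => phi (false :: u))) (IH (fun u => phi (true :: u))) addrC.
Qed.

(** Isolates the signs of one block, so that the others can be averaged while
    that block is kept fixed. *)
Lemma mean_block m l n phi :
  mean (m + (l + n)) phi =
  mean l (fun w => mean (m + n) (fun v => phi (take m v ++ w ++ drop m v))).
Proof.
rewrite mean_cat.
under eq_mean do rewrite mean_cat.
rewrite mean_exchange; apply: eq_mean => w _; rewrite mean_cat.
apply: eq_mean => u su; apply: eq_mean => v _.
by rewrite take_size_cat// drop_size_cat.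
Qed.

Lemma mean_walk2 n : mean n (fun u => walk u ^+ 2) = n%:R.
Proof.
elim: n => [|n IH] /=; first by rewrite walk_nil expr0n.
under eq_mean do rewrite walk_cons.
under [X in _ + X]eq_mean do rewrite walk_cons.
rewrite -meanD (@eq_mean _ _ (fun u => 2 * (walk u ^+ 2 + 1))); last first.
  by move=> u _; rewrite /sign; ring.
by rewrite meanZ meanD mean_cst IH -natr1; field.
Qed.

Lemma mean_walk4 n :
  mean n (fun u => walk u ^+ 4) = 3 * n%:R ^+ 2 - 2 * n%:R.
Proof.
elim: n => [|n IH] /=; first by rewrite walk_nil expr0n /=; ring.
under eq_mean do rewrite walk_cons.
under [X in _ + X]eq_mean do rewrite walk_cons.
rewrite -meanD (@eq_mean _ _ (fun u => 2 * (walk u ^+ 4 + (6 * walk u ^+ 2 + 1)))); last first.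
  by move=> u _; rewrite /sign; ring.
by rewrite meanZ meanD IH meanD mean_cst meanZ mean_walk2 -natr1; field.
Qed.

(** A polynomial form of the Paley-Zygmund argument. Put n = s^2: the quadratic
    (S^2 - n/4) (4 n - S^2) in S^2 is at most (15 n / 8)^2, and it is negative
    when S^2 < n/4, whereas its mean is at least n^2/4 by the second and fourth
    moments. Hence |S| >= s/2 has probability at least 16/225, and by symmetry
    half of it goes to S >= s/2. *)
Lemma walk_tail (s : nat) : (0 < s)%N ->
  32^-1 <= mean (s ^ 2) (fun u => (s%:R / 2 <= walk u)%R%:R).
Proof.
move=> s0; set n := (s ^ 2)%N; set t : R := s%:R.
have tp : 0 < t by rewrite ltr0n.
have nE : n%:R = t ^+ 2 by rewrite natrX.
set I := fun u => _.
have sym : mean n I = mean n (fun u => (t / 2 <= - walk u)%R%:R).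
  by rewrite -mean_negb; apply: eq_mean => u _; rewrite /I walk_negb.
(* 64 / 225 = (8 / 15)^2 normalizes the maximum of the quadratic to 1. *)
suff : 64 / 225 * (t ^+ 4 / 4) <= t ^+ 4 * (mean n I + mean n I).
  rewrite mulrCA ler_pM2l ?exprn_gt0//; lra.
rewrite {2}sym -meanD -meanZ.
apply: (@le_trans _ _ (mean n (fun u => 64 / 225 *
    (17 / 4 * t ^+ 2 * walk u ^+ 2 + ((-1) * walk u ^+ 4 + (- t ^+ 4)))))).
  rewrite meanZ meanD meanZ mean_walk2 meanD meanZ mean_walk4 mean_cst nE.
  have := sqr_ge0 t; set x := t ^+ 2 => x0.
  have -> : t ^+ 4 = x ^+ 2 by rewrite -exprM.
  nra.
apply: le_mean => u _; rewrite /I.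
set S := walk u.
have x4 : S ^+ 4 = (S ^+ 2) ^+ 2 by rewrite -exprM.
have t4 : t ^+ 4 = (t ^+ 2) ^+ 2 by rewrite -exprM.
have key : 64 / 225 * (17 / 4 * t ^+ 2 * S ^+ 2 + ((-1) * S ^+ 4 + (- t ^+ 4))) <= t ^+ 4.
  rewrite x4 t4; move: (S ^+ 2) (t ^+ 2) => x y.
  have := sqr_ge0 (x - 17 / 8 * y); nra.
have t4p : 0 <= t ^+ 4 by rewrite exprn_ge0// ltW.
have [h1|h1] := leP (t / 2) S.
  by rewrite (le_trans key)// ler_peMr// lerDl ler0n.
have [h2|h2] := leP (t / 2) (- S).
  by rewrite (le_trans key)// add0r mulr1.
rewrite addr0 mulr0 x4 t4.
have : S ^+ 2 <= t ^+ 2 / 4 by nra.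
have : 0 <= S ^+ 2 := sqr_ge0 S.
move: (S ^+ 2) (t ^+ 2) => x y x0 xy; nra.
Qed.

(** Asking each of c consecutive blocks to gain s/2 produces a deviation of
    order sqrt c standard deviations, at a cost that depends on c but not on
    the scale s. *)
Lemma walk_tailM (s c : nat) : (0 < s)%N ->
  32^-1 ^+ c <= mean (c * s ^ 2) (fun u => (c%:R * (s%:R / 2) <= walk u)%R%:R).
Proof.
move=> s0; elim: c => [|c IH].
  by rewrite mul0n /= walk_nil mul0r lexx expr0.
rewrite mulSn mean_cat exprS.
apply: (@le_trans _ _ (mean (s ^ 2) (fun u => (s%:R / 2 <= walk u)%R%:R *
  mean (c * s ^ 2) (fun v => (c%:R * (s%:R / 2) <= walk v)%R%:R)))).
  under eq_mean do rewrite mulrC.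
  rewrite meanZ mulrC ler_pM ?walk_tail ?exprn_ge0 ?invr_ge0 ?ler0n//.
apply: le_mean => u _; rewrite -meanZ; apply: le_mean => v _.
rewrite walk_cat -natrM ler_nat mulnb.
case: andP => //= -[h1 h2].
by rewrite -natr1 mulrDl mul1r addrC lerD.
Qed.

End Signs.

(** * Trees of blocks and the quadratic variation of a walk *)

Section Tree.
Variable R : realType.
Implicit Types (u v : seq bool).
Local Notation walk := (@walk R).
Local Notation mean := (@mean R).

Definition block (l a : nat) u := take l (drop (a * l) u).

(** The number of steps that lie in no selected block, when the blocks of a tree
    are inspected from the top and a block is selected once its increment is at
    least K times the square root of its length. The branching number is a
    square, [l ^ 2], to make these square roots the integers [l ^ m]. *)
Fixpoint uncovered (l K m : nat) u : R :=
  if m is m'.+1 then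
    if (K * l ^ m)%:R <= `|walk u| then 0
    else \sum_(a < l ^ 2) uncovered l K m' (block ((l ^ 2) ^ m') a u)
  else 1.

(** A single sum that controls the increments over all blocks of the tree. The
    fourth power is what makes its mean a geometric series dominated by the
    root; with squares every level would contribute equally. *)
Fixpoint walk4_tree (l m : nat) u : R :=
  walk u ^+ 4 +
  if m is m'.+1 then \sum_(a < l ^ 2) walk4_tree l m' (block ((l ^ 2) ^ m') a u)
  else 0.

Lemma uncovered_ge0 l K m u : 0 <= uncovered l K m u.
Proof.
elim: m u => [|m IH] u //=; case: ifP => // _; exact: sumr_ge0.
Qed.

Lemma walk4_tree_ge0 l m u : 0 <= walk4_tree l m u.
Proof.
have h v : 0 <= walk v ^+ 4 by rewrite exprn_even_ge0.
elim: m u => [|m IH] u /=; first by rewrite addr0.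
by rewrite addr_ge0// sumr_ge0.
Qed.

Lemma block_count l a c : (a < c)%N ->
  (c * l = a * l + (l + (c - a.+1) * l))%N.
Proof. by move=> ac; rewrite -mulSn -mulnDl; congr muln; lia. Qed.

Lemma block_ins l a w x y : size x = (a * l)%N -> size w = l ->
  block l a (x ++ w ++ y) = w.
Proof. by move=> sx sw; rewrite /block drop_size_cat// take_size_cat. Qed.

Lemma mean_blockE l a c (phi : seq bool -> R) : (a < c)%N ->
  mean (c * l) (fun u => phi (block l a u)) = mean l phi.
Proof.
move=> ac; rewrite (block_count _ ac) mean_block; apply: eq_mean => w sw.
rewrite -[RHS](mean_cst (a * l + (c - a.+1) * l)); apply: eq_mean => v sv.
by rewrite block_ins// size_takel// sv leq_addr.
Qed.

Lemma mean_walk4_tree l m : (1 < l)%N ->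
  mean ((l ^ 2) ^ m) (walk4_tree l m) <= 6 * ((l ^ 2) ^ m)%:R ^+ 2.
Proof.
move=> l1; have w4 n : mean n (fun u => walk u ^+ 4) <= 3 * n%:R ^+ 2.
  by rewrite mean_walk4 gerBl mulr_ge0.
elim: m => [|m IH].
  rewrite expn0 (le_trans _ (_ : 3 * 1 <= _))//; last by lra.
  by have := w4 1%N; under eq_mean => u _ do rewrite -[walk u ^+ 4]addr0;
    rewrite expr1n.
pose N := ((l ^ 2) ^ m)%N; rewrite -/N in IH.
rewrite /= meanD expnS -/N (le_trans (lerD (w4 _) (lexx _)))//.
rewrite mean_sum (eq_bigr (fun=> mean N (walk4_tree l m))); last first.
  by move=> a _; rewrite mean_blockE.
rewrite sumr_const card_ord -[X in _ + X]mulr_natl natrM exprMn.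
have L4 : 4 <= (l ^ 2)%:R :> R by rewrite ler_nat -(leq_exp2r _ _ (ltn0Sn 1)) in l1 *.
move: L4 IH; move: (l ^ 2)%:R (N%:R) (mean N _) => L n e L4 IH.
have : L * e <= L * (6 * n ^+ 2) by rewrite ler_pM2l//; lra.
have := sqr_ge0 n; move: (n ^+ 2) => n2 n20 h.
have h2 : 0 <= (L - 4) * (L * n2) by rewrite !mulr_ge0//; lra.
have h3 : 0 <= L * n2 by rewrite mulr_ge0//; lra.
lra.
Qed.

(** Decouples a block [w] from the block that contains it: whatever the sign of
    the increment over [w], the remaining steps push at least as far as [y] in
    the same direction with probability at least [p], by symmetry, and then
    the increment over the large block is at least [y] in absolute value. *)
Lemma uncovered_block (p y : R) (w : seq bool) n (phi : seq bool -> R)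
  (g : seq bool -> seq bool) :
  0 <= phi w ->
  p <= mean n (fun v => (y <= walk v)%R%:R) ->
  (forall v, size v = n -> walk (g v) = walk w + walk v) ->
  mean n (fun v => (`|walk (g v)| < y)%R%:R * phi w) <= (1 - p) * phi w.
Proof.
move=> phi0 hp hg; under eq_mean do rewrite mulrC.
rewrite meanZ mulrC ler_wpM2r// lerBrDr -lerBrDl.
have key (psi : seq bool -> R) : (forall v, size v = n ->
    ((`|walk (g v)| < y)%R%:R : R) <= 1 - psi v) -> p <= mean n psi ->
    p <= 1 - mean n (fun v => (`|walk (g v)| < y)%R%:R).
  move=> h pl; apply: (le_trans pl); rewrite lerBrDl -lerBrDr -[X in X - _](mean_cst n 1).
  rewrite -[- _]mulN1r -meanZ -meanD; apply: le_mean => v sv.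
  by rewrite mulN1r; exact: h.
have [w0|w0] := leP 0 (walk w).
  apply: key hp => v sv; rewrite hg//.
  have [yv|] := leP y (walk v); last by rewrite subr0 lern1 leq_b1.
  by rewrite subrr lern0 eqb0 -leNgt ler_normr; apply/orP; left; lra.
apply: (key (fun v => (y <= - walk v)%R%:R)).
  move=> v sv; rewrite hg//.
  have [yv|] := leP y (- walk v); last by rewrite subr0 lern1 leq_b1.
  by rewrite subrr lern0 eqb0 -leNgt ler_normr; apply/orP; right; lra.
rewrite -mean_negb (le_trans hp)//; apply: le_mean => v _.
by rewrite walk_negb opprK.
Qed.

(** Going up one level, a step that is still uncovered remains so with
    conditional probability at most 1 - p, where p bounds from below the
    probability that the other l^2 - 1 blocks gain l^m / 2 each. The choice
    l = 2 K + 1 ensures (l^2 - 1) l^m / 2 >= K l^(m+1). *)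
Lemma mean_uncovered K m (l := (2 * K + 1)%N) : (0 < K)%N ->
  mean ((l ^ 2) ^ m) (uncovered l K m) <=
    ((l ^ 2)%:R * (1 - 32^-1 ^+ (l ^ 2).-1)) ^+ m.
Proof.
move=> K0; set p : R := 32^-1 ^+ _.
have p1 : p <= 1 by rewrite exprn_ile1 ?invr_ge0 ?ler0n// invf_le1 ?ler1n ?ltr0n.
have l0 : (0 < l)%N by rewrite /l addn1.
elim: m => [|m IH]; first by rewrite expn0 expr0 /=; lra.
pose N := ((l ^ 2) ^ m)%N; rewrite -/N in IH.
have NE : N = ((l ^ m) ^ 2)%N by rewrite /N -!expnM mulnC.
set y : R := (K * l ^ m.+1)%:R.
have L0 : (0 < l ^ 2)%N by rewrite expn_gt0 l0.
rewrite expnS -/N (@le_trans _ _ (mean (l ^ 2 * N) (fun u =>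
  \sum_(a < l ^ 2) (`|walk u| < y)%R%:R * uncovered l K m (block N a u))))//.
  apply: le_mean => u _ /=; rewrite -/y; have [h|h] := leP y `|walk u|.
    by rewrite sumr_ge0// => a _; rewrite mul0r.
  by under [leRHS]eq_bigr do rewrite mul1r.
rewrite mean_sum exprS -[(l ^ 2)%:R * _ * _]mulrA mulr_natl.
set z := (1 - p) * _.
have -> : z *+ l ^ 2 = \sum_(a < l ^ 2) z by rewrite sumr_const card_ord.
apply: ler_sum => a _; rewrite /z.
rewrite (le_trans _ (_ : (1 - p) * mean N (uncovered l K m) <= _))//; last first.
  by rewrite ler_wpM2l// subr_ge0.
rewrite (block_count _ (ltn_ord a)) mean_block -meanZ; apply: le_mean => w sw.
set n := (a * N + _)%N.
have nE : n = ((l ^ 2).-1 * N)%N.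
  by rewrite /n -mulnDl; congr muln; have := ltn_ord a; lia.
rewrite (@eq_mean _ _ _ (fun v => (`|walk (take (a * N) v ++ w ++ drop (a * N) v)| < y)%R%:R
    * uncovered l K m w)); last first.
  by move=> v sv; rewrite block_ins// size_takel// sv leq_addr.
apply: uncovered_block => //; first exact: uncovered_ge0.
  have lm0 : (0 < l ^ m)%N by rewrite expn_gt0 l0.
  rewrite nE NE; apply: (le_trans (walk_tailM R _ lm0)).
  apply: le_mean => v _; rewrite ler_nat.
  apply: (@leq_trans (y <= walk v)%R) => //.
  have le_y : y <= (l ^ 2).-1%:R * ((l ^ m)%:R / 2).
    rewrite mulrA ler_pdivlMr ?ltr0n// /y -!natrM ler_nat expnS.
    have : (K * l * 2 <= (l ^ 2).-1)%N by rewrite /l; nia.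
    by nia.
  by case: leP => // /(le_trans le_y) ->.
by move=> v _; rewrite !walk_cat addrCA -(walk_cat _ (take _ v)) cat_take_drop.
Qed.

Fixpoint path_sum (w : nat -> nat -> R) (s : nat) (p : seq nat) : R :=
  if p is t :: p' then w s t + path_sum w t p' else 0.

Lemma path_sum_cat w s p p' :
  path_sum w s (p ++ p') = path_sum w s p + path_sum w (last s p) p'.
Proof. by elim: p s => [|t p IH] s /=; rewrite ?add0r// IH addrA. Qed.

Lemma norm_le_exp4 (x c : R) : 0 <= c -> x ^+ 4 <= c ^+ 4 -> `|x| <= c.
Proof.
move=> c0 h; rewrite -(@ler_pXn2r _ 4) ?nnegrE//.
by rewrite -normrX ger0_norm// exprn_even_ge0.
Qed.

(** The maximal selected blocks, in increasing order and completed by single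
    steps, form a partition. The bound on [walk4_tree] keeps the increments
    over the selected blocks in the range where the weight [w] is known to
    dominate their squares. *)
Lemma cover_partition (l K : nat) (u : seq bool) (w : nat -> nat -> R)
    (kap c : R) : 0 <= kap -> 0 <= c ->
  (forall s t, 0 <= w s t) ->
  (forall s t, (s <= t <= size u)%N ->
     `|walk (take (t - s) (drop s u))| <= c ->
     kap * walk (take (t - s) (drop s u)) ^+ 2 <= w s t) ->
  forall m o, let b := take ((l ^ 2) ^ m) (drop o u) in
  (o + (l ^ 2) ^ m <= size u)%N ->
  walk4_tree l m b <= c ^+ 4 ->
  exists p, [/\ path leq o p, last o p = (o + (l ^ 2) ^ m)%N &
    kap * K%:R ^+ 2 * (((l ^ 2) ^ m)%:R - uncovered l K m b) <= path_sum w o p].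
Proof.
move=> kap0 c0 w0 hw; elim=> [|m IH] o b.
  move=> _ _; exists [:: (o + (l ^ 2) ^ 0)%N]; split=> //=.
    by rewrite leq_addr.
  by rewrite expn0 subrr mulr0 addr0.
pose N := ((l ^ 2) ^ m)%N; rewrite -/N in IH.
have NS : ((l ^ 2) ^ m.+1 = l ^ 2 * N)%N by rewrite expnS.
move=> ou /= hb.
have sub_ge0 : 0 <= \sum_(a < l ^ 2) walk4_tree l m (block N a b).
  by apply: sumr_ge0 => a _; exact: walk4_tree_ge0.
have bc : `|walk b| <= c.
  by apply: norm_le_exp4 => //; apply: le_trans hb; rewrite lerDl.
case: ifP => hK.
  exists [:: (o + (l ^ 2) ^ m.+1)%N]; split=> //=; first by rewrite leq_addr.
  rewrite addr0 subr0.
  have := @hw o (o + (l ^ 2) ^ m.+1)%N.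
  rewrite leq_addr ou addKn => /(_ isT bc); apply: le_trans.
  rewrite -mulrA ler_wpM2l//.
  have -> : walk b ^+ 2 = `|walk b| ^+ 2 by rewrite real_normK// num_real.
  apply: (@le_trans _ _ ((K * l ^ m.+1)%:R ^+ 2)).
    by rewrite -!natrX -natrM ler_nat expnMn -!expnM [(2 * _)%N]mulnC.
  by rewrite ler_pXn2r// nnegrE.
have key j : (j <= l ^ 2)%N -> exists p, [/\ path leq o p,
    last o p = (o + j * N)%N &
    kap * K%:R ^+ 2 * \sum_(a < j) (N%:R - uncovered l K m (block N a b))
      <= path_sum w o p].
  elim: j => [|j IHj] jl.
    by exists [::]; split; rewrite //= ?mul0n ?addn0// big_ord0 mulr0.
  have [p [pp lp sp]] := IHj (ltnW jl).
  have bE : block N j b = take N (drop (o + j * N) u).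
    rewrite /block /b NS -(addnC (j * N)) -drop_drop.
    have -> : (l ^ 2 * N = (l ^ 2 * N - j * N) + j * N)%N.
      by rewrite subnK// leq_mul2r (ltnW jl) orbT.
    rewrite -take_drop take_takel// -mulnBl -{1}[N]mul1n leq_mul2r.
    by apply/orP; right; rewrite subn_gt0.
  have h1 : (o + j * N + N <= size u)%N.
    apply: leq_trans ou; rewrite -addnA leq_add2l NS addnC -mulSn.
    by rewrite leq_mul2r jl orbT.
  have h2 : walk4_tree l m (take N (drop (o + j * N) u)) <= c ^+ 4.
    rewrite -bE; apply: le_trans hb.
    rewrite (bigD1 (Ordinal jl))//= addrCA lerDl addr_ge0//.
      by rewrite exprn_even_ge0.
    by apply: sumr_ge0 => a _; exact: walk4_tree_ge0.
  have [p' [pp' lp' sp']] := IH _ h1 h2.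
  exists (p ++ p'); split.
  - by rewrite cat_path pp lp.
  - by rewrite last_cat lp lp' -addnA mulSn (addnC N).
  - by rewrite path_sum_cat lp big_ord_recr /= mulrDr lerD// bE.
have [p [pp lp sp]] := key _ (leqnn _).
exists p; split=> //; first by rewrite NS.
apply: le_trans sp; rewrite sumrB sumr_const card_ord.
by have -> : ((l ^ 2) ^ m.+1)%:R = N%:R *+ (l ^ 2) :> R by rewrite NS natrM mulr_natl.
Qed.

(** The weight [w] stands for a power of the increments of another process that
    follows the walk. For a Riesz product the comparison breaks down when its
    argument makes a full turn, hence the restriction to increments of at most
    three standard deviations [s]. *)
Definition splits_well (K s : nat) (u : seq bool) : Prop :=
  forall (kap : R) (w : nat -> nat -> R), 0 <= kap ->
  (forall i j, 0 <= w i j) ->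
  (forall i j, (i <= j <= size u)%N ->
     `|walk (take (j - i) (drop i u))| <= 3 * s%:R ->
     kap * walk (take (j - i) (drop i u)) ^+ 2 <= w i j) ->
  exists p, [/\ path leq 0%N p, last 0%N p = size u &
    kap * K%:R ^+ 2 * ((size u)%:R / 2) <= path_sum w 0%N p].

(** The bad events are that more than half of the steps are uncovered and that
    some block has an increment above 3 s. Markov's inequality bounds the first
    by 2 q^m, at most 1/4 for a deep tree, and the second by 6/81. *)
Theorem most_walks_split (K : nat) : (0 < K)%N ->
  exists2 s : nat, (0 < s)%N &
    2^-1 <= mean (s ^ 2) (fun u => `[< splits_well K s u >]%:R).
Proof.
move=> K0; set l := (2 * K + 1)%N.
set q : R := 1 - 32^-1 ^+ (l ^ 2).-1.
have q0 : 0 <= q by rewrite subr_ge0 exprn_ile1 ?invr_ge0 ?ler0n// invf_le1 ?ler1n ?ltr0n.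
have q1 : q < 1 by rewrite gtrBl exprn_gt0// invr_gt0 ltr0n.
have [m qm] : exists m, q ^+ m <= 8^-1.
  have /cvgrPdist_le /(_ 8^-1) := @cvg_expr R q (ltac:(by rewrite ger0_norm)).
  rewrite invr_gt0 ltr0n => /(_ isT) [m _ /(_ m (leqnn m))] /=.
  by rewrite sub0r normrN ger0_norm ?exprn_ge0// => h; exists m.
have l0 : (0 < l)%N by rewrite /l addn1.
exists (l ^ m)%N; first by rewrite expn_gt0 l0.
set s := (l ^ m)%N; have nE : (s ^ 2 = (l ^ 2) ^ m)%N by rewrite /s -!expnM mulnC.
set n := (s ^ 2)%N.
have sp : 0 < s%:R :> R by rewrite ltr0n expn_gt0 l0.
have np : 0 < n%:R :> R by rewrite natrX exprn_gt0.
have c4 : (3 * s%:R) ^+ 4 = 81 * n%:R ^+ 2 :> R.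
  have -> : n%:R = s%:R ^+ 2 :> R by rewrite /n natrX.
  by ring.
apply: (@le_trans _ _ (mean n (fun u => 1 + ((- (2 / n%:R)) * uncovered l K m u
   + (- (81 * n%:R ^+ 2)^-1) * walk4_tree l m u)))).
  rewrite meanD meanD mean_cst !meanZ.
  have := mean_uncovered m K0; rewrite -/l -/q -nE -/n exprMn.
  have -> : (l ^ 2)%:R ^+ m = n%:R :> R by rewrite /n nE [RHS]natrX.
  move=> hu.
  have l1 : (1 < l)%N by rewrite /l; lia.
  have := mean_walk4_tree m l1; rewrite -nE -/n => hw.
  have {hu} : 2 / n%:R * mean n (uncovered l K m) <= 4^-1.
    rewrite mulrAC ler_pdivrMr//; nra.
  have {hw} : (81 * n%:R ^+ 2)^-1 * mean n (walk4_tree l m) <= 4^-1.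
    rewrite mulrC ler_pdivrMr ?mulr_gt0 ?exprn_gt0//; have := exprn_gt0 2 np; nra.
  lra.
apply: le_mean => u su.
have U0 := uncovered_ge0 l K m u; have W0 := walk4_tree_ge0 l m u.
case: asboolP => [_|bad].
  have : 0 <= 2 / n%:R * uncovered l K m u by rewrite !mulr_ge0// invr_ge0 ltW.
  have : 0 <= (81 * n%:R ^+ 2)^-1 * walk4_tree l m u.
    by rewrite mulr_ge0// invr_ge0 mulr_ge0// exprn_ge0// ltW.
  by move=> h1 h2; rewrite /=; lra.
have [hW|hW] := leP (walk4_tree l m u) (81 * n%:R ^+ 2); last first.
  have : 1 <= (81 * n%:R ^+ 2)^-1 * walk4_tree l m u.
    by rewrite mulrC ler_pdivlMr ?mul1r ?ltW// mulr_gt0// exprn_gt0.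
  have : 0 <= 2 / n%:R * uncovered l K m u by rewrite !mulr_ge0// invr_ge0 ltW.
  by move=> h1 h2; rewrite /=; lra.
have [hU|hU] := leP (uncovered l K m u) (n%:R / 2); last first.
  have : 1 <= 2 / n%:R * uncovered l K m u.
    by rewrite mulrAC ler_pdivlMr// mul1r; lra.
  have : 0 <= (81 * n%:R ^+ 2)^-1 * walk4_tree l m u.
    by rewrite mulr_ge0// invr_ge0 mulr_ge0// exprn_ge0// ltW.
  by move=> h1 h2; rewrite /=; lra.
exfalso; apply: bad => kap w kap0 w0 hw.
have c0 : 0 <= 3 * s%:R :> R by rewrite mulr_ge0.
have := @cover_partition l K u w kap (3 * s%:R) kap0 c0 w0 hw m 0%N.
rewrite drop0 add0n -nE -/n take_oversize ?su//.
rewrite leqnn c4 => /(_ isT hW) [p [pp lp sp']].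
exists p; split=> //; apply: le_trans sp'.
by rewrite ler_wpM2l ?mulr_ge0 ?exprn_ge0//; lra.
Qed.

End Tree.

(** * Weyl differencing over a finite field *)

Section Weyl.
Variable R : realType.

(** What the differencing argument retains of a polynomial of degree d + 1 with
    invertible leading coefficient: after d differences a bijection is left. *)
Fixpoint nondegenerate (F : finFieldType) (d : nat) (Q : F -> F) : Prop :=
  if d is d'.+1 then
    forall h : F, h != 0 -> nondegenerate d' (fun n => Q (n + h) - Q n)
  else injective Q.

(** If Q has degree d + 1 and leading coefficient c, then Q (X + h) - Q has
    degree d and leading coefficient (d + 1) h c, which is not zero as long as
    the characteristic exceeds d + 1. *)
Lemma nondegenerate_poly (F : finFieldType) (d : nat) (Q : {poly F}) :
  (forall j, (0 < j <= d.+1)%N -> j%:R != 0 :> F) ->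
  size Q = d.+2 -> nondegenerate d (fun x => Q.[x]).
Proof.
suff gen (f : F -> F) : (forall j, (0 < j <= d.+1)%N -> j%:R != 0 :> F) ->
    size Q = d.+2 -> (forall x, f x = Q.[x]) -> nondegenerate d f.
  by move=> h1 h2; apply: gen.
elim: d Q f => [|d IH] Q f hF sQ fE /=.
  move=> x y; rewrite !fE [Q](_ : _ = Q`_1 *: 'X + (Q`_0)%:P); last first.
    apply/polyP => -[|[|i]]; rewrite coefD coefZ coefX coefC ?mulr0 ?add0r ?mulr1 ?addr0//=.
    by rewrite nth_default// sQ.
  rewrite !hornerE => /addIr; apply: mulfI.
  by have := lead_coef_eq0 Q; rewrite lead_coefE sQ /= -size_poly_eq0 sQ => ->.
move=> h h0; set Q' := Q \Po ('X + h%:P) - Q.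
have coefXh i j : (('X + h%:P) ^+ i)`_j = h ^+ (i - j) *+ 'C(i, j).
  rewrite addrC exprDn coef_sum.
  have [ij|ji] := ltnP i j.
    rewrite bin_small// big1// => k _.
    rewrite coefMn -rmorphXn /= coefCM coefXn gtn_eqF ?mulr0 ?mul0rn//.
    by rewrite (leq_ltn_trans (leq_ord k) ij).
  rewrite (bigD1 (Ordinal (ji : (j < i.+1)%N)))//= big1 ?addr0.
    by rewrite coefMn -rmorphXn /= coefCM coefXn eqxx mulr1.
  move=> k; rewrite -val_eqE /= => kj.
  by rewrite coefMn -rmorphXn /= coefCM coefXn eq_sym (negPf kj) mulr0 mul0rn.
have coefQ' j : Q'`_j = \sum_(i < d.+3) Q`_i * (h ^+ (i - j) *+ 'C(i, j)) - Q`_j.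
  rewrite coefB comp_polyE coef_sum sQ; congr (_ - _); apply: eq_bigr => i _.
  by rewrite coefZ coefXh.
have c0 j : (d.+2 <= j)%N -> Q'`_j = 0.
  move=> dj; rewrite coefQ' big_ord_recr big1 /= ?add0r; last first.
    by move=> i _; rewrite bin_small ?mulr0n ?mulr0// (leq_trans (ltn_ord i)).
  move: dj; rewrite leq_eqVlt => /orP[/eqP <-|dj].
    by rewrite subnn expr0 binn mulr1 subrr.
  by rewrite bin_small// mulr0n mulr0 nth_default ?subrr// sQ.
have c1 : Q'`_d.+1 = Q`_d.+2 * (h * d.+2%:R).
  rewrite coefQ' 2!big_ord_recr big1 /= ?add0r; last first.
    by move=> i _; rewrite bin_small ?mulr0n ?mulr0.
  by rewrite subnn binn subSnn binSn expr0 expr1 mulr1 addrAC subrr add0r mulr_natr.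
have sQ' : size Q' = d.+2.
  apply/eqP; rewrite eqn_leq; apply/andP; split.
    by apply/leq_sizeP => j; exact: c0.
  rewrite ltnNge; apply/negP => /leq_sizeP /(_ d.+1 (leqnn _)); apply/eqP.
  rewrite c1 !mulf_neq0 ?hF//=.
  by have := lead_coef_eq0 Q; rewrite lead_coefE sQ /= -size_poly_eq0 sQ => ->.
apply: (IH Q') => //.
- by move=> j /andP[j0 jd]; apply: hF; rewrite j0 ltnW.
- by move=> x; rewrite !fE /Q' !hornerE horner_comp !hornerE.
Qed.

(** Up to the factor #|F|^3, the mean square over x of the average of
    s (x + Q n) over n. *)
Definition energy (F : finFieldType) (s : F -> R) (Q : F -> F) : R :=
  \sum_x (\sum_n s (x + Q n)) ^+ 2.

(** Van der Corput's identity: expand the square with m = n + h as the second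
    summation variable, then translate x by Q n. *)
Lemma energy_shift (F : finFieldType) (s : F -> R) (Q : F -> F) :
  energy s Q = \sum_h \sum_y s y * \sum_n s (y + (Q (n + h) - Q n)).
Proof.
rewrite /energy.
under eq_bigr => x _ do rewrite expr2 mulr_suml.
rewrite exchange_big /=.
under eq_bigr => n _.
  under eq_bigr => x _.
    rewrite mulr_sumr (reindex_inj (addrI n)) /=.
    over.
  rewrite exchange_big /=.
  under eq_bigr => h _.
    rewrite (reindex_inj (subIr (Q n))) /=.
    under eq_bigr => y _ do rewrite subrK -addrA [- Q n + _]addrC.
    over.
  over.
rewrite exchange_big /=; apply: eq_bigr => h _.
rewrite exchange_big /=; apply: eq_bigr => y _.
by rewrite mulr_sumr.
Qed.

(** Equidistribution without exponential sums. In [energy_shift] the term h = 0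
    is a proportion 1 / #|F| of the trivial bound, and for h != 0 the inner sum
    B enters through |B| <= B^2 / t + t / 4, hence through the energy of the
    differenced function, which is small by induction on d. When Q is a
    bijection, every sum of s (x + Q n) over n is the sum of s, at most 1. *)
Lemma weyl (d : nat) (e : R) : 0 < e -> exists q0 : nat,
  forall (F : finFieldType) (s : F -> R) (Q : F -> F),
  (q0 <= #|F|)%N -> (forall x, `|s x| <= 1) -> `|\sum_x s x| <= 1 ->
  nondegenerate d Q -> energy s Q <= e * #|F|%:R ^+ 3.
Proof.
have inv_small (c : R) : 0 < c -> exists q0 : nat, forall q : nat,
    (q0 <= q)%N -> 1 <= c * q%:R.
  move=> c0; exists (Num.bound c^-1) => q hq.
  rewrite mulrC -ler_pdivrMr// div1r ltW// (lt_le_trans (archi_boundP _))//.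
    by rewrite invr_ge0 ltW.
  by rewrite ler_nat.
elim: d e => [|d IH] e e0.
  have [q0 hq0] := inv_small e e0; exists q0 => F s Q /hq0 q1 s1 sm /= Qinj.
  set q : R := #|F|%:R in q1 *.
  have q0' : 0 < q by rewrite ltr0n; apply/card_gt0P; exists 0.
  have q1' : 1 <= q by rewrite ler1n -(ltr0n R).
  rewrite /energy (@le_trans _ _ (\sum_(x : F) 1))//.
    apply: ler_sum => x _.
    have -> : \sum_n s (x + Q n) = \sum_n s n.
      have inj : injective (fun n => x + Q n) by move=> a b /addrI /Qinj.
      by rewrite [RHS](reindex_inj inj).
    by rewrite -(@real_normK _ (\sum_n _)) ?num_real// exprn_ile1.
  have -> : \sum_(x : F) 1 = q by rewrite sumr_const.
  have h1 : 0 <= (e * q - 1) * (q * q) by rewrite !mulr_ge0 ?subr_ge0// ltW.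
  have h2 : 0 <= (q - 1) * q by rewrite mulr_ge0 ?subr_ge0// ltW.
  lra.
(* With t = e q the bound B^2 / t + t / 4 turns an energy e^2 q^3 / 2 into
   (e / 2 + e / 4) q^2; the last e / 4 is for h = 0. *)
have e2 : 0 < e ^+ 2 / 2 by rewrite divr_gt0// exprn_gt0.
have [qa ha] := IH _ e2.
have e4 : 0 < e / 4 by rewrite divr_gt0.
have [qb hb] := inv_small _ e4; exists (maxn qa qb) => F s Q.
rewrite geq_max => /andP[/ha {}ha /hb {}hb] s1 sm /= Qnd.
set q : R := #|F|%:R in ha hb *.
have q0 : 0 < q by rewrite ltr0n; apply/card_gt0P; exists 0.
rewrite energy_shift (bigD1 0)//=.
have sum1 (A : F -> R) c : (forall x, A x <= c) -> \sum_x A x <= c * q.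
  move=> hA; rewrite (@le_trans _ _ (\sum_(x : F) c))//; first exact: ler_sum.
  by rewrite sumr_const -[leLHS]mulr_natr.
have sB (f : F -> F) : `|\sum_n s (f n)| <= q.
  rewrite (le_trans (ler_norm_sum _ _ _))//.
  by rewrite (le_trans (sum1 _ 1 _))// mul1r.
have b0 : \sum_y s y * \sum_n s (y + (Q (n + 0) - Q n)) <= q * q.
  apply: sum1 => y; rewrite (le_trans (ler_norm _))// normrM -[leRHS]mul1r.
  by rewrite ler_pM ?normr_ge0 ?s1 ?sB.
have bh h : h != 0 ->
    \sum_y s y * \sum_n s (y + (Q (n + h) - Q n)) <= (3 / 4 * e * q) * q.
  move=> h0; have hE := ha s _ s1 sm (Qnd h h0).
  set E := energy _ _ in hE.
  rewrite (@le_trans _ _ (\sum_y ((e * q)^-1 *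
     (\sum_n s (y + (Q (n + h) - Q n))) ^+ 2 + e * q / 4)))//.
    apply: ler_sum => y _; rewrite (le_trans (ler_norm _))// normrM.
    set B := \sum_n _; rewrite (@le_trans _ _ `|B|)//.
      by rewrite ler_piMl.
    have eq0 : 0 < e * q by rewrite mulr_gt0.
    rewrite -(@ler_pM2l _ (e * q))// mulrDr mulrA divff ?gt_eqF// mul1r.
    rewrite -(@real_normK _ B) ?num_real//.
    have := sqr_ge0 (`|B| - e * q / 2); nra.
  rewrite big_split /= -mulr_sumr -[X in _ * X + _]/E.
  have : (e * q)^-1 * E <= e / 2 * q ^+ 2.
    rewrite ler_pdivrMl ?mulr_gt0//.
    have := hE; rewrite -/q; set x := e ^+ 2 / 2 * _.
    have -> : e * q * (e / 2 * q ^+ 2) = x by rewrite /x; ring.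
    by apply.
  have := sum1 (fun=> e * q / 4) _ (fun=> lexx _); lra.
have : \sum_(h | h != 0) \sum_y s y * \sum_n s (y + (Q (n + h) - Q n))
    <= (3 / 4 * e * q * q) * q.
  rewrite (@le_trans _ _ (\sum_(h : F | h != 0) (3 / 4 * e * q * q)))//.
    exact: ler_sum.
  rewrite (@le_trans _ _ (\sum_(h : F) (3 / 4 * e * q * q)))//.
    by rewrite [leRHS](bigD1 0)//= lerDr !mulr_ge0// ltW.
  exact: sum1.
have : q * q <= e / 4 * q * (q * q) by rewrite ler_peMl// mulr_ge0// ltW.
lra.
Qed.
End Weyl.

(** * Signs of residues modulo a prime *)

Section Residues.
Variable R : realType.

(** Half of Z/q, so that its signs nearly cancel over an equidistributed
    sequence, and an interval, so that short translations rarely change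
    membership. *)
Definition low_half (q : nat) (y : int) : bool := ((y%:~R : 'F_q) * 2 < q)%N.

Lemma low_half_periodic q y (c : nat) : prime q -> low_half q (y + (c * q)%:Z) = low_half q y.
Proof.
move=> pq; rewrite /low_half PoszM intrD intrM -[(q%:Z)%:~R]/(q%:R).
by rewrite pchar_Fp_0// mulr0 addr0.
Qed.

Lemma low_half_nat q (x : nat) : prime q -> (x < q)%N ->
  low_half q x%:Z = (x * 2 < q)%N.
Proof. by move=> pq xq; rewrite /low_half -[(x%:Z)%:~R]/(x%:R) val_Fp_nat// modn_small. Qed.

(** The two ways in which a residue x can be relied upon: until time N the orbit
    does not leave the half of x, and over a full period it spends nearly the
    same time in both halves. *)
Definition typical (P : {poly int}) (tau : R) (N q x : nat) : Prop :=
  (forall m, (1 <= m <= N)%N -> low_half q (x%:Z + P.[m%:Z]) = low_half q x%:Z) /\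
  `|\sum_(n < q) sign R (low_half q (x%:Z + P.[(n : nat)%:Z]))| <= tau * q%:R.

Lemma sum_Fp q (g : 'F_q -> R) : prime q ->
  \sum_(n < q) g (n : nat)%:R = \sum_z g z.
Proof.
move=> pq; have bij : bijective (fun n : 'I_q => (n : nat)%:R : 'F_q).
  apply: inj_card_bij; last by rewrite card_Fp// card_ord.
  move=> a b /(congr1 val) /=; rewrite !val_Fp_nat// !modn_small ?ltn_ord//.
  exact: val_inj.
by rewrite (reindex _ (onW_bij _ bij)).
Qed.

Lemma sum_interval (a b q : nat) : (b <= q)%N ->
  b%:R - a%:R <= \sum_(x < q) (a <= x < b)%N%:R :> R.
Proof.
move=> bq; have [ab|/ltnW ba] := leqP a b; last first.
  by rewrite (@le_trans _ _ 0)// ?subr_le0 ?ler_nat// sumr_ge0.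
rewrite -natrB// -[(b - a)%:R](sumr_const_nat b a 1).
rewrite (big_nat_widen _ _ _ _ _ bq) (big_nat_widenl _ _ _ _ _ (leq0n a)) big_mkord.
rewrite big_mkcond /=; apply: ler_sum => x _.
by rewrite andbC; case: ifP.
Qed.

Lemma sum_sign_halves q : prime q -> (2 < q)%N ->
  \sum_(z : 'F_q) sign R ((z : nat) * 2 < q)%N = 1.
Proof.
move=> pq q2; rewrite -(sum_Fp (fun z : 'F_q => sign R ((z : nat) * 2 < q)%N))//.
under eq_bigr => n _ do rewrite val_Fp_nat// modn_small//.
have [k kE] : exists k, q = k.*2.+1.
  exists q./2; rewrite -[LHS]odd_double_half.
  by case: (even_prime pq) => [e|->]; [rewrite e in q2|].
rewrite kE {q pq q2 kE}.
rewrite -(big_mkord xpredT (fun n => sign R (n * 2 < k.*2.+1)%N)).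
rewrite (@big_cat_nat _ _ _ k.+1)//=; last by rewrite ltnS -addnn leq_addr.
rewrite (eq_big_nat _ _ (F2 := fun=> 1)); last first.
  by move=> i /andP[_ ik]; rewrite /sign ifT//; lia.
rewrite [X in _ + X](eq_big_nat _ _ (F2 := fun=> -1)); last first.
  by move=> i /andP[ki _]; rewrite /sign ifF//; lia.
rewrite !sumr_const_nat subn0.
have -> : (k.*2.+1 - k.+1 = k)%N by lia.
by rewrite mulrSr mulNrn addrAC subrr add0r.
Qed.

(** With q = 2 k + 1 the halves are [0, k] and [k + 1, 2 k], and a point at
    distance H from both ends of its half is not moved out of it by z. *)
Lemma halves_stable (q k H x : nat) (z : int) (b : bool) :
  (`|z| <= H)%N -> q = k.*2.+1 ->
  ((if b then H else k.+1 + H) <= x)%N ->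
  (x < (if b then k.+1 - H else q - H))%N ->
  exists y : nat, [/\ x%:Z + z = y%:Z, (y < q)%N & (y * 2 < q)%N = b].
Proof.
move=> zH ->; case: b => lox xhi; exists (absz (x%:Z + z)%R); split; lia.
Qed.

(** The first requirement fails only within a fixed distance H of the ends of
    the halves, H being a bound for |P| on [0, N]; the second fails rarely by
    Chebyshev's inequality and [weyl]. *)
Lemma most_typical (P : {poly int}) (tau delta : R) (N : nat) :
  (1 < size P)%N -> 0 < tau -> 0 < delta ->
  exists B : nat, forall q, prime q -> (B <= q)%N -> forall b : bool,
    (1 - delta) * (q%:R / 2) <=
    \sum_(x < q) `[< typical P tau N q x /\ low_half q (x : nat)%:Z = b >]%:R.
Proof.
move=> sP tau0 delta0.
have [d sPd] : exists d, size P = d.+2 by exists (size P).-2; lia.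
set c := lead_coef P; have c0 : c != 0.
  by rewrite lead_coef_eq0 -size_poly_eq0 sPd.
have e0 : 0 < tau ^+ 2 * delta / 8 by rewrite !mulr_gt0 ?exprn_gt0.
have [q0 hw] := weyl d e0.
pose H := (\sum_(m < N.+1) `|P.[(m : nat)%:Z]|)%N.
have hH m : (m <= N)%N -> (`|P.[m%:Z]| <= H)%N.
  by move=> mN; rewrite /H (bigD1 (Ordinal (mN : (m < N.+1)%N)))//= leq_addr.
pose B1 := Num.bound ((1 + 2 * H%:R) * 8 / delta).
exists (maxn q0 (3 + d + `|c| + 2 * H + B1))%N => q pq.
rewrite geq_max => /andP[q0q Bq] b.
have q2 : (2 < q)%N by lia.
have qp : 0 < q%:R :> R by rewrite ltr0n; lia.
pose Q : {poly 'F_q} := map_poly intr P.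
pose s (z : 'F_q) := sign R ((z : nat) * 2 < q)%N.
have sE (y : int) : sign R (low_half q y) = s y%:~R by [].
have natF j : (0 < j < q)%N -> j%:R != 0 :> 'F_q.
  move=> /andP[j0 jq]; rewrite -(dvdn_pcharf (pchar_Fp pq)).
  by apply/negP => /(dvdn_leq j0); rewrite leqNgt jq.
have sQ : size Q = d.+2.
  rewrite size_map_poly_id0 ?sPd// -/c [c]intEsign rmorphM rmorph_sign.
  by rewrite mulf_neq0 ?signr_eq0//= natF// absz_gt0 c0; lia.
have nd : nondegenerate d (fun x => Q.[x]).
  by apply: nondegenerate_poly sQ => j hj; apply: natF; lia.
have := hw 'F_q s (fun x => Q.[x]); rewrite card_Fp// => /(_ q0q).
have s1 x : `|s x| <= 1.
  by rewrite /s /sign; case: ifP => _; rewrite ?normrN normr1.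
have ssum : `|\sum_x s x| <= 1 by rewrite sum_sign_halves// normr1.
move=> /(_ s1 ssum nd) hE {hw}.
pose S (x : nat) := \sum_(n < q) sign R (low_half q (x%:Z + P.[(n : nat)%:Z])).
have SE x : S x = \sum_z s (x%:R + Q.[z]).
  rewrite -(sum_Fp (fun z => s (x%:R + Q.[z])))//; apply: eq_bigr => n _.
  by rewrite sE rmorphD /= -horner_map.
have sumS : \sum_(x < q) S x ^+ 2 <= tau ^+ 2 * delta / 8 * q%:R ^+ 3.
  apply: le_trans hE; rewrite /energy -(sum_Fp (fun x => (\sum_z s (x + Q.[z])) ^+ 2))//.
  by apply: ler_sum => x _; rewrite SE.
have [k kE] : exists k, q = k.*2.+1.
  exists q./2; rewrite -[LHS]odd_double_half.
  by case: (even_prime pq) => [e|->]; [rewrite e in q2|].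
pose lo := if b then H else (k.+1 + H)%N.
pose hi := if b then (k.+1 - H)%N else (q - H)%N.
have hiq : (hi <= q)%N by rewrite /hi; case: ifP => _; lia.
have len : q%:R / 2 - (1 + 2 * H%:R) <= hi%:R - lo%:R :> R.
  have qR : q%:R = k%:R * 2 + 1 :> R by rewrite kE -natr1 -muln2 natrM.
  have k1 : k.+1%:R = k%:R + 1 :> R by rewrite -natr1.
  rewrite /hi /lo; case: ifP => _.
    rewrite natrB; last by lia.
    by rewrite k1 qR; have : 0 <= H%:R :> R := ler0n _ _; lra.
  rewrite natrB; last by lia.
  by rewrite natrD k1 qR; have : 0 <= H%:R :> R := ler0n _ _; lra.
have B1q : 1 + 2 * H%:R <= delta * q%:R / 8.
  rewrite ler_pdivlMr// -ler_pdivrMl// mulrC.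
  rewrite ltW// (lt_le_trans (archi_boundP _))//.
    by rewrite divr_ge0 ?mulr_ge0 ?addr_ge0 ?mulr_ge0// ltW.
  by rewrite ler_nat -/B1; clear -Bq; lia.
apply: (@le_trans _ _ (\sum_(x < q) ((lo <= x < hi)%N%:R - S x ^+ 2 / (tau * q%:R) ^+ 2))).
  rewrite big_split /= sumrN -mulr_suml.
  have : (\sum_(x < q) S x ^+ 2) / (tau * q%:R) ^+ 2 <= delta / 8 * q%:R.
    rewrite ler_pdivrMr ?exprn_gt0 ?mulr_gt0//.
    by apply: (le_trans sumS); rewrite le_eqVlt; apply/orP; left; apply/eqP; ring.
  have := mulr_gt0 delta0 qp; have := sum_interval lo hiq; lra.
apply: ler_sum => x _.
have S2 : 0 <= S x ^+ 2 / (tau * q%:R) ^+ 2.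
  by rewrite divr_ge0 ?sqr_ge0.
case: (boolP (lo <= x < hi)%N) => [/andP[lox xhi]|_]; last first.
  by rewrite sub0r (@le_trans _ _ 0)// oppr_le0.
have [hS|hS] := leP `|S x| (tau * q%:R); last first.
  rewrite (@le_trans _ _ 0)// subr_le0 ler_pdivlMr ?exprn_gt0 ?mulr_gt0// mul1r.
  rewrite -(@real_normK _ (S x)) ?num_real//.
  by apply: lerXn2r; rewrite ?nnegrE ?normr_ge0 ?mulr_ge0 ?(ltW tau0) ?(ltW hS).
case: asboolP => [_|bad]; first by rewrite lerBlDr lerDl.
exfalso; apply: bad.
have stable (z : int) : (`|z| <= H)%N -> low_half q ((x : nat)%:Z + z) = b.
  move=> zH; have [y [-> yq yb]] := halves_stable zH kE lox xhi.
  by rewrite low_half_nat.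
have lowx : low_half q (x : nat)%:Z = b by rewrite -[X in low_half q X]addr0 stable.
by split=> //; split=> // m /andP[m1 mN]; rewrite lowx stable// hH.
Qed.

End Residues.

(** * Independence of residues and sparse times *)

Section CRT.
Variable A : comNzRingType.

Definition periodic (T : Type) (q : nat) (u : nat -> T) := forall n c, u (n + c * q)%N = u n.

Lemma periodic_mod (T : Type) q (u : nat -> T) n : periodic q u -> u (n %% q)%N = u n.
Proof. by move=> pu; rewrite [in RHS](divn_eq n q) addnC pu. Qed.

Lemma sum_crt (a b : nat) (u v : nat -> A) :
  (0 < a)%N -> (0 < b)%N -> coprime a b -> periodic a u -> periodic b v ->
  \sum_(x < a * b) u x * v x = (\sum_(x < a) u x) * (\sum_(x < b) v x).
Proof.
move=> a0 b0 cab pu pv.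
rewrite mulr_suml; under [RHS]eq_bigr do rewrite mulr_sumr.
rewrite pair_big /=.
pose h (x : 'I_(a * b)) : 'I_a * 'I_b :=
  (Ordinal (ltn_pmod x a0), Ordinal (ltn_pmod x b0)).
have bij : bijective h.
  apply: inj_card_bij; last by rewrite card_prod !card_ord.
  move=> x y [/eqP xa /eqP xb].
  have := chinese_remainder cab x y; rewrite xa xb /= !modn_small ?ltn_ord//.
  by move=> /eqP /val_inj.
rewrite (reindex h) /=; last exact: onW_bij.
by apply: eq_bigr => x _; rewrite !periodic_mod.
Qed.

Variable q : nat -> nat.
Definition prodq (j : nat) : nat := \prod_(i < j) q i.

Lemma prodqS j : prodq j.+1 = (prodq j * q j)%N.
Proof. by rewrite /prodq big_ord_recr. Qed.

Hypothesis q0 : forall i, (0 < q i)%N.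
Hypothesis qco : forall j, coprime (prodq j) (q j).

Lemma prodq_gt0 j : (0 < prodq j)%N.
Proof. by apply: prodn_gt0. Qed.

Lemma periodic_prod j (u : nat -> nat -> A) :
  (forall i, (i < j)%N -> periodic (q i) (u i)) ->
  periodic (prodq j) (fun x => \prod_(i < j) u i x).
Proof.
move=> pu n c; apply: eq_bigr => i _.
have /dvdnP[d ->] : (q i %| prodq j)%N by rewrite /prodq (bigD1 i)//= dvdn_mulr.
by rewrite mulnA pu.
Qed.

Lemma sum_crt_prod j (u : nat -> nat -> A) :
  (forall i, (i < j)%N -> periodic (q i) (u i)) ->
  \sum_(x < prodq j) \prod_(i < j) u i x = \prod_(i < j) \sum_(x < q i) u i x.
Proof.
elim: j => [|j IH] pu.
  by rewrite /prodq !big_ord0 big_ord1 big_ord0.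
rewrite prodqS; under eq_bigr do rewrite big_ord_recr.
rewrite (@sum_crt _ _ (fun x => \prod_(i < j) u i x) (u j)) ?prodq_gt0//; last 2 first.
- by apply: periodic_prod => i ij; apply: pu; rewrite ltnW.
- exact: pu.
by rewrite big_ord_recr/= IH// => i ij; apply: pu; rewrite ltnW.
Qed.

End CRT.

Section Joint.
Variable R : realType.
Variable q : nat -> nat.
Hypothesis q0 : forall i, (0 < q i)%N.
Hypothesis qco : forall j, coprime (prodq q j) (q j).

(** The residues of a uniform x modulo Q are independent. A factor 1 - delta is
    lost for each coordinate as the event that x is good there with a given bit
    has a probability only slightly below 1/2. *)
Lemma joint_law (delta : R) (n : nat) (good bit : nat -> nat -> bool)
    (phi : seq bool -> R) :
  0 <= delta <= 1 ->
  (forall u, 0 <= phi u) ->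
  (forall i, periodic (q i) (good i)) ->
  (forall i, periodic (q i) (bit i)) ->
  (forall i (b : bool), (1 - delta) * ((q i)%:R / 2) <=
     \sum_(x < q i) (good i x && (bit i x == b))%:R) ->
  (1 - delta) ^+ n * (prodq q n)%:R * mean n phi <=
  \sum_(x < prodq q n) phi (mkseq (fun i => bit i x) n) * \prod_(i < n) (good i x)%:R.
Proof.
move=> /andP[d0 d1] + pg pb hq.
elim: n phi => [|n IH] phi phi0.
  by rewrite /prodq big_ord0 big_ord1 big_ord0 expr0 mulr1 /=; lra.
have split_bit x : phi (mkseq (fun i => bit i x) n.+1) * \prod_(i < n.+1) (good i x)%:R =
    \sum_(b : bool) (phi (rcons (mkseq (fun i => bit i x) n) b) * \prod_(i < n) (good i x)%:R)
      * (good n x && (bit n x == b))%:R.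
  rewrite /mkseq -addn1 iotaD map_cat /= cats1 addn1 big_ord_recr /= add0n.
  rewrite mulrA [RHS](bigD1 (bit n x))//= eqxx andbT [X in _ = _ + X]big1 ?addr0// => b.
  by rewrite eq_sym => /negPf ->; rewrite andbF mulr0.
under [leRHS]eq_bigr do rewrite split_bit.
rewrite mean_rcons prodqS natrM exprS exchange_big /=.
have per b : periodic (prodq q n) (fun x => phi (rcons (mkseq (fun i => bit i x) n) b)
     * \prod_(i < n) ((good i x)%:R : R)).
  move=> x c; congr (_ * _); last first.
    by apply: (@periodic_prod _ q n (fun i x => (good i x)%:R)) => i _ y d; rewrite pg.
  congr (phi (rcons _ b)); apply/eq_in_map => i; rewrite mem_iota add0n /= => ni.
  have /dvdnP[d ->] : (q i %| prodq q n)%N.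
    by rewrite /prodq (bigD1 (Ordinal ni))//= dvdn_mulr.
  by rewrite mulnA pb.
have step b : (1 - delta) ^+ n * (prodq q n)%:R * mean n (fun u => phi (rcons u b)) *
     ((1 - delta) * ((q n)%:R / 2)) <=
   \sum_(x < prodq q n * q n) (phi (rcons (mkseq (fun i => bit i x) n) b) *
      \prod_(i < n) (good i x)%:R) * (good n x && (bit n x == b))%:R.
  rewrite (@sum_crt _ _ _ (fun x => phi (rcons (mkseq (fun i => bit i x) n) b)
     * \prod_(i < n) ((good i x)%:R : R)) (fun x => (good n x && (bit n x == b))%:R))//.
  - rewrite ler_pM ?mulr_ge0 ?exprn_ge0 ?subr_ge0 ?mean_ge0//.
      exact: (IH (fun u => phi (rcons u b))).
  - exact: prodq_gt0.
  - by move=> x c; rewrite pg pb.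
by have := lerD (step true) (step false); rewrite big_bool /=; lra.
Qed.
End Joint.

Section Times.
Variable R : realType.

(** Times and primes are chosen alternately, each large enough for the previous
    ones; only the product of the primes and the last time are carried along.
    A prime larger than the product of its predecessors is coprime to it. *)
Lemma sparse_times (I : set nat) (eps : R) (good : nat -> nat -> Prop) :
  infinite_set I -> 0 < eps ->
  (forall N, exists B, forall q, prime q -> (B <= q)%N -> good N q) ->
  exists (N q : nat -> nat),
   [/\ forall j, I (N j), forall i j, (i <= j)%N -> (N i <= N j)%N,
       forall j, prime (q j) /\ good (N j) (q j),
       forall j, coprime (prodq q j) (q j) &
       forall j, (prodq q j)%:R <= eps * (N j)%:R].
Proof.
move=> Iinf eps0 hgood.
have /choice[nextN hN] (b : nat) : exists N, I N /\ (b <= N)%N.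
  apply: contrapT => hb; apply: Iinf; apply: (sub_finite_set _ (finite_II b)).
  by move=> N IN /=; rewrite ltnNge; apply/negP => bN; apply: hb; exists N.
have /choice[nextq hq] (Nb : nat * nat) : exists q, [/\ prime q, (Nb.2 < q)%N & good Nb.1 q].
  have [B hB] := hgood Nb.1; have [q bq pq] := prime_above (maxn B Nb.2).
  by exists q; split=> //; [lia|apply: hB => //; lia].
pose bound (Q : nat) := Num.bound (Q%:R / eps).
pose tm (st : nat * nat) := nextN (maxn (bound st.1) st.2).
pose pr (st : nat * nat) := nextq (tm st, st.1).
pose fix state (j : nat) : nat * nat :=
  if j is j'.+1 then
    let st := state j' in ((st.1 * pr st)%N, tm st)
  else (1%N, 0%N).
pose N j := tm (state j); pose q j := pr (state j).
have sQ j : (state j).1 = prodq q j.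
  elim: j => [|j IH]; first by rewrite /prodq big_ord0.
  by rewrite prodqS -IH.
have sN j : (state j.+1).2 = N j by [].
have tmP st : I (tm st) /\ (maxn (bound st.1) st.2 <= tm st)%N by exact: hN.
have prP st : [/\ prime (pr st), (st.1 < pr st)%N & good (tm st) (pr st)] := hq _.
exists N, q; split.
- by move=> j; have [] := tmP (state j).
- move=> i j /subnK <-; elim: (j - i)%N => // d IH; apply: (leq_trans IH).
  by rewrite addSn -sN; have [_] := tmP (state (d + i).+1); rewrite geq_max => /andP[].
- by move=> j; have [] := prP (state j).
- move=> j; have [pq lq _] := prP (state j); rewrite coprime_sym prime_coprime//.
  have Q0 : (0 < prodq q j)%N.
    by apply: prodq_gt0 => i; have [+ _ _] := prP (state i); exact: prime_gt0.
  apply/negP => /(dvdn_leq Q0); rewrite -sQ leqNgt => /negP; exact.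
- move=> j; have [_] := tmP (state j); rewrite geq_max => /andP[+ _].
  rewrite -(ler_nat R) => h; rewrite mulrC -ler_pdivrMr// -sQ (le_trans _ h)//.
  by rewrite ltW// archi_boundP// divr_ge0// ltW.
Qed.
End Times.

(** * Complex estimates *)

Section ComplexEstimates.
Variable R : realType.
Local Notation nc := (@ComplexField.Normc.normc R).
Implicit Types (z w : R[i]).

Lemma nc_ge0 z : 0 <= nc z. Proof. by case: z => x y; exact: sqrtr_ge0. Qed.

Lemma ncM z w : nc (z * w) = nc z * nc w.
Proof. exact: ComplexField.Normc.normcM. Qed.

Lemma ncD z w : nc (z + w) <= nc z + nc w.
Proof. exact: le_normcD. Qed.

Lemma ncN z : nc (- z) = nc z. Proof. exact: normcN. Qed.

Lemma nc1 : nc 1 = 1. Proof. exact: ComplexField.Normc.normc1. Qed.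

Lemma nc0 : nc 0 = 0. Proof. exact: ComplexField.Normc.normc0. Qed.

Lemma nc_nat n : nc n%:R = n%:R.
Proof. by rewrite normcMn nc1. Qed.

Lemma nc_invnat n : nc n%:R^-1 = n%:R^-1.
Proof. by rewrite ComplexField.Normc.normcV nc_nat. Qed.

Lemma nc_sum (J : Type) (r : seq J) (p : pred J) (F : J -> R[i]) :
  nc (\sum_(j <- r | p j) F j) <= \sum_(j <- r | p j) nc (F j).
Proof.
apply: (big_ind2 (fun z x => nc z <= x)) => //; first by rewrite nc0.
by move=> z x w y zx wy; rewrite (le_trans (ncD _ _))// lerD.
Qed.

Lemma Im_le_nc z : `|complex.Im z| <= nc z.
Proof.
case: z => x y /=; rewrite -sqrtr_sqr ler_sqrt ?sqr_ge0//.
  by rewrite lerDr sqr_ge0.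
by rewrite addr_ge0// sqr_ge0.
Qed.

Lemma nc_prod_le (a : R) (n : nat) (J : finType) (p : pred J) (F : J -> R[i]) :
  (#|p| <= n)%N -> (1 + a ^+ 2) ^+ n <= 4 ->
  (forall j, nc (F j) ^+ 2 <= 1 + a ^+ 2) -> nc (\prod_(j | p j) F j) <= 2.
Proof.
move=> pn an hF.
have a1 : 1 <= 1 + a ^+ 2 by rewrite lerDl sqr_ge0.
suff h : nc (\prod_(j | p j) F j) ^+ 2 <= 2 ^+ 2.
  by rewrite -(@ler_pXn2r _ 2) ?nnegrE ?nc_ge0.
have -> : (2 : R) ^+ 2 = 4 by rewrite -natrX.
apply: le_trans an; apply: (@le_trans _ _ ((1 + a ^+ 2) ^+ #|p|)); last exact: ler_weXn2l.
rewrite -prodr_const.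
apply: (@le_trans _ _ (\prod_(j | p j) nc (F j) ^+ 2)); last first.
  by apply: ler_prod => j _; rewrite sqr_ge0 hF.
rewrite le_eqVlt; apply/orP; left; apply/eqP.
by apply: (big_ind2 (fun z x => nc z ^+ 2 = x)) => //;
  [rewrite nc1 expr1n|move=> z x w y <- <-; rewrite ncM exprMn].
Qed.

(** Telescoping: replace the factors by 1 one at a time. *)
Lemma nc_prod_sub1 (j : nat) (z : nat -> R[i]) :
  (forall k, (k <= j)%N -> nc (\prod_(i < k) z i) <= 2) ->
  nc (\prod_(i < j) z i - 1) <= 2 * \sum_(i < j) nc (z i - 1).
Proof.
elim: j => [|j IH] h; first by rewrite !big_ord0 subrr nc0 mulr0.
rewrite !big_ord_recr /= mulrDr.
have -> : \prod_(i < j) z i * z j - 1 =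
    (\prod_(i < j) z i - 1) + \prod_(i < j) z i * (z j - 1) by ring.
rewrite (le_trans (ncD _ _))// lerD ?IH//; first by move=> k kj; rewrite h// ltnW.
by rewrite ncM ler_wpM2r ?nc_ge0 ?h.
Qed.

(** After subtracting the mean over a period, complete periods cancel and less
    than one period is left. *)
Lemma avg_periodic (Q N : nat) (B : R) (u : nat -> R[i]) :
  (0 < Q)%N -> (0 < N)%N -> periodic Q u -> (forall m, nc (u m) <= B) ->
  nc (N%:R^-1 * \sum_(1 <= m < N.+1) u m - Q%:R^-1 * \sum_(m < Q) u m)
    <= 2 * B * (Q%:R / N%:R).
Proof.
move=> Q0 N0 pu uB; set A := Q%:R^-1 * _.
have B0 : 0 <= B := le_trans (nc_ge0 _) (uB 0%N).
have AB : nc A <= B.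
  rewrite ncM nc_invnat ler_pdivrMl ?ltr0n// (le_trans (nc_sum _ _ _))//.
  rewrite (@le_trans _ _ (\sum_(m < Q) B))//; first exact: ler_sum.
  by rewrite sumr_const card_ord mulr_natl.
pose v m := u m - A.
have pv : periodic Q v by move=> m c; rewrite /v pu.
have vB m : nc (v m) <= 2 * B.
  by rewrite (le_trans (ncD _ _))// ncN mulr2n mulrDl mul1r lerD.
have sv0 : \sum_(m < Q) v m = 0.
  rewrite sumrB sumr_const card_ord -mulr_natl /A mulrA divff ?mul1r ?subrr//.
  by rewrite pnatr_eq0 -lt0n.
have svc c : \sum_(0 <= m < c * Q) v m.+1 = 0.
  elim: c => [|c IH]; first by rewrite mul0n big_nil.
  rewrite mulSn addnC (@big_cat_nat _ _ _ (c * Q))//= ?leq_addr// IH add0r.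
  rewrite -{1}[(c * Q)%N]add0n big_addn addKn.
  under eq_bigr do rewrite -addSn pv.
  have e : v 0%N + \sum_(0 <= i < Q) v i.+1 = \sum_(0 <= i < Q) v i + v Q.
    by rewrite -big_nat_recl// big_nat_recr.
  have vQ : v Q = v 0%N by rewrite -(pv 0%N 1%N) add0n mul1n.
  rewrite -[RHS]sv0 -(big_mkord xpredT v).
  by apply: (addrI (v 0%N)); rewrite e vQ addrC.
have -> : N%:R^-1 * \sum_(1 <= m < N.+1) u m - A = N%:R^-1 * \sum_(0 <= m < N) v m.+1.
  rewrite big_add1 /= sumrB sumr_const_nat subn0 mulrBr -[A *+ N]mulr_natl.
  by rewrite mulrA mulVf ?mul1r// pnatr_eq0 -lt0n.
rewrite ncM nc_invnat mulrC mulrA ler_pM2r ?invr_gt0 ?ltr0n//.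
rewrite (@big_cat_nat _ _ _ (N %/ Q * Q))//= ?leq_divM// svc add0r.
rewrite (le_trans (nc_sum _ _ _))//.
rewrite (@le_trans _ _ (\sum_(N %/ Q * Q <= m < N) (2 * B)))//; first exact: ler_sum.
rewrite sumr_const_nat -[leLHS]mulr_natr.
rewrite ler_wpM2l ?mulr_ge0// ler_nat.
by rewrite {1}(divn_eq N Q) addKn ltnW// ltn_pmod.
Qed.

(** The factor 1 + i a or 1 - i a. Its modulus does not depend on the sign, which
    keeps the products bounded for every path. *)
Definition riesz_factor (a : R) (b : bool) : R[i] := Complex 1 (a * sign R b).

Lemma nc_riesz_factor a b : nc (riesz_factor a b) ^+ 2 = 1 + a ^+ 2.
Proof.
rewrite /= sqr_sqrtr ?addr_ge0 ?sqr_ge0// expr1n; congr (_ + _).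
by case: b; rewrite /sign ?mulr1 ?mulrN1 ?sqrrN.
Qed.

Definition riesz_prod (a : R) (u : seq bool) : R[i] := \prod_(b <- u) riesz_factor a b.

(** A pair of opposite signs contributes (1 + i a) (1 - i a) = 1 + a^2 >= 1, so
    after cancellation only |S| equal factors are left, up to a real constant at
    least 1. *)
Lemma riesz_prod_form (a : R) (u : seq bool) : exists (c : R) (k : nat) (e : bool),
  [/\ 1 <= c, `|walk R u| = k%:R & riesz_prod a u = c%:C%C * riesz_factor a e ^+ k].
Proof.
suff [c [k [e [c1 wk pk]]]] : exists (c : R) (k : nat) (e : bool),
  [/\ 1 <= c, walk R u = k%:R * sign R e & riesz_prod a u = c%:C%C * riesz_factor a e ^+ k].
  exists c, k, e; split=> //; rewrite wk normrM ger0_norm//.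
  by rewrite /sign; case: (e); rewrite ?normrN normr1 mulr1.
elim: u => [|b u [c [k [e [c1 wk pk]]]]].
  by exists 1, 0%N, true; rewrite walk_nil mul0r /riesz_prod big_nil expr0 mulr1.
have pE : riesz_prod a (b :: u) = riesz_factor a b * riesz_prod a u by rewrite /riesz_prod big_cons.
rewrite walk_cons pE pk wk.
have [->|bne] := eqVneq b e.
  exists c, k.+1, e; split=> //; first by rewrite -natr1 mulrDl mul1r addrC.
  by rewrite exprS mulrCA.
have eE : e = ~~ b by case: b e {pE pk wk} bne => [] [].
have sN : sign R e = - sign R b by rewrite eE /sign; case: (b); rewrite /= ?opprK.
case: k wk pk => [|k] wk pk.
  exists c, 1%N, b; split=> //; first by rewrite mul0r addr0 mul1r.
  by rewrite expr0 mulr1 expr1 mulrC.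
exists (c * (1 + a ^+ 2)), k, e; split.
- by rewrite -[leLHS]mulr1 ler_pM// lerDl sqr_ge0.
- by rewrite sN -natr1; ring.
- have -> : (c * (1 + a ^+ 2))%R%:C%C = c%:C%C * (riesz_factor a b * riesz_factor a e).
    rewrite rmorphM /=; congr (_ * _); apply/eqP; rewrite eq_complex /= sN.
    have s2 : sign R b * sign R b = 1 by rewrite /sign; case: (b); rewrite ?mulrNN mulr1.
    apply/andP; split; apply/eqP; last by ring.
    by transitivity (1 + a ^+ 2 * (sign R b * sign R b)); [rewrite s2 mulr1|ring].
  by rewrite exprS; ring.
Qed.

(** While k a <= 1/2, the real part of the power stays between 1/2 and 1, and it
    drives the imaginary part at a speed between a/2 and a. *)
Lemma Im_riesz_factorX (a : R) (e : bool) (k : nat) : 0 <= a -> k%:R * a <= 2^-1 ->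
  k%:R * a / 2 <= `|complex.Im (riesz_factor a e ^+ k)|.
Proof.
move=> a0 ka.
suff h : exists x y : R, [/\ riesz_factor a e ^+ k = Complex x (y * sign R e),
    1 - k%:R * a <= x, x <= 1, k%:R * a / 2 <= y & y <= k%:R * a].
  have [x [y [-> _ _ hy _]]] := h; rewrite /= normrM.
  have -> : `|sign R e| = 1 by rewrite /sign; case: (e); rewrite ?normrN normr1.
  by rewrite mulr1 (le_trans hy)// ler_norm.
elim: k ka => [|k IH] ka.
  by exists 1, 0; split; rewrite ?mul0r ?subr0.
have k1 : k.+1%:R = k%:R + 1 :> R by rewrite -natr1.
have ka' : k%:R * a <= 2^-1 by rewrite (le_trans _ ka)// k1 mulrDl lerDl mul1r.
have [x [y [pE x1 x2 y1 y2]]] := IH ka'.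
have k0 : 0 <= k%:R * a by rewrite mulr_ge0.
exists (x - a * y), (y + a * x); rewrite k1 in ka *; split.
- rewrite exprS pE; apply/eqP; rewrite eq_complex /=.
  have s2 : sign R e * sign R e = 1 by rewrite /sign; case: (e); rewrite ?mulrNN mulr1.
  apply/andP; split; apply/eqP; last by ring.
  by transitivity (x - a * y * (sign R e * sign R e)); [ring|rewrite s2 mulr1].
- have : 0 <= a * (1 - y) by rewrite mulr_ge0//; lra.
  lra.
- have : 0 <= a * y by rewrite mulr_ge0//; lra.
  lra.
- have : 0 <= a * (x - 2^-1) by rewrite mulr_ge0//; lra.
  lra.
- have : 0 <= a * (1 - x) by rewrite mulr_ge0//; lra.
  lra.
Qed.

Lemma riesz_prod_sub1 (a : R) (u : seq bool) : 0 <= a -> `|walk R u| * a <= 2^-1 ->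
  `|walk R u| * a / 2 <= nc (riesz_prod a u - 1).
Proof.
move=> a0; have [c [k [e [c1 -> ->]]]] := riesz_prod_form a u => ka.
apply: le_trans (Im_le_nc _).
apply: (le_trans (Im_riesz_factorX e a0 ka)).
have -> : complex.Im (c%:C%C * riesz_factor a e ^+ k - 1) = c * complex.Im (riesz_factor a e ^+ k).
  by case: (riesz_factor a e ^+ k) => x y /=; rewrite mul0r addr0 subr0.
by rewrite normrM ler_peMl// ger0_norm// (le_trans _ c1).
Qed.

Lemma nc_riesz_prod_ge1 a u : 1 <= nc (riesz_prod a u).
Proof.
rewrite /riesz_prod; elim/big_ind : _ => //; first by rewrite nc1.
  by move=> z w z1 w1; rewrite ncM -[leLHS]mulr1 ler_pM.
move=> b _; rewrite -(@ler_pXn2r _ 2) ?nnegrE ?nc_ge0// nc_riesz_factor expr1n.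
by rewrite lerDl sqr_ge0.
Qed.

End ComplexEstimates.

(** * Averages of the Riesz product *)

Section Averages.
Variable R : realType.
Local Notation nc := (@ComplexField.Normc.normc R).

Lemma sum_Complex (J : Type) (r : seq J) (x y : J -> R) :
  \sum_(j <- r) Complex (x j) (y j) = Complex (\sum_(j <- r) x j) (\sum_(j <- r) y j).
Proof.
elim: r => [|j r IH]; first by rewrite !big_nil.
by rewrite !big_cons IH.
Qed.

Lemma mean_riesz_factor (a : R) (q : nat) (b : nat -> bool) : (0 < q)%N ->
  q%:R^-1 * \sum_(m < q) riesz_factor a (b m) =
  Complex 1 (a * ((\sum_(m < q) sign R (b m)) / q%:R)).
Proof.
move=> q0; have qn0 : q%:R != 0 :> R by rewrite pnatr_eq0 -lt0n.
have qC0 : q%:R != 0 :> R[i] by rewrite pnatr_eq0 -lt0n.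
apply: (mulfI qC0); rewrite mulVKf// sum_Complex.
rewrite -[q%:R in RHS](rmorph_nat (@real_complex R)).
apply/eqP; rewrite eq_complex /= !mul0r subr0 addr0 mulr1; apply/andP; split.
  by rewrite sumr_const card_ord.
by rewrite -mulr_sumr; apply/eqP; field.
Qed.

Lemma nc_Complex1 (t : R) : nc (Complex 1 t) ^+ 2 = 1 + t ^+ 2.
Proof. by rewrite /= sqr_sqrtr ?addr_ge0 ?sqr_ge0// expr1n. Qed.

Lemma nc_Complex1_sub1 (t : R) : nc (Complex 1 t - 1) = `|t|.
Proof. by rewrite /= subrr subr0 expr0n add0r sqrtr_sqr. Qed.

Lemma nc_riesz_prod_le2 (a : R) (n : nat) (u : seq bool) :
  (size u <= n)%N -> (1 + a ^+ 2) ^+ n <= 4 -> nc (riesz_prod a u) <= 2.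
Proof.
move=> un an; rewrite /riesz_prod (big_nth true) big_mkord.
apply: (nc_prod_le (a := a) (n := n)) => //; first by rewrite card_ord.
by move=> j; rewrite nc_riesz_factor.
Qed.

(** A polynomial with integer coefficients is periodic modulo q. *)
Lemma low_half_poly_periodic (P : {poly int}) (q : nat) (x : int) : prime q ->
  periodic q (fun m => low_half q (x + P.[m%:Z])).
Proof.
move=> pq m c; rewrite /low_half.
suff -> : (x + P.[(m + c * q)%N%:Z])%:~R = (x + P.[m%:Z])%:~R :> 'F_q by [].
have hm (k : int) : (map_poly intr P).[k%:~R] = P.[k]%:~R :> 'F_q.
  exact: horner_map.
rewrite !intrD -!hm PoszD PoszM intrD intrM.
by rewrite -[(q%:Z)%:~R]/(q%:R) pchar_Fp_0// mulr0 addr0.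
Qed.

Variables (P : {poly int}) (a : R) (n : nat) (N q : nat -> nat).
Hypothesis a0 : 0 < a.
Hypothesis n0 : (0 < n)%N.
Hypothesis an : (1 + a ^+ 2) ^+ n <= 4.
Hypothesis N0 : forall j, (0 < N j)%N.
Hypothesis Nmono : forall i j, (i <= j)%N -> (N i <= N j)%N.
Hypothesis qprime : forall i, prime (q i).
Hypothesis qco : forall j, coprime (prodq q j) (q j).
Hypothesis qN : forall j, (prodq q j)%:R <= a / 128 * (N j)%:R.

Definition bits (x : nat) := mkseq (fun i => low_half (q i) x%:Z) n.
(** Defined on the integers, where translations by the values of P make sense
    before any period has been fixed. *)
Definition riesz_fun (y : int) : R[i] := \prod_(i < n) riesz_factor a (low_half (q i) y).
Definition avg (M x : nat) : R[i] :=
  M%:R^-1 * \sum_(1 <= m < M.+1) riesz_fun (x%:Z + P.[m%:Z]).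

Definition all_typical (x : nat) := forall i, (i < n)%N ->
  typical P ((64 * n%:R)^-1 : R) (N i) (q i) x.

(** The factors with index at least j are constant along the orbit up to time
    N_j and come out of the average. The others form a product of period
    Q_j, whose mean over a period is the product of the means of its factors,
    each within a * tau of 1 with tau = 1 / (64 n). *)
Lemma avg_close (j x : nat) : (j <= n)%N -> all_typical x ->
  nc (avg (N j) x - riesz_prod a (drop j (bits x))) <= a / 8.
Proof.
move=> jn tx; set M := riesz_prod a _.
have q0 i : (0 < q i)%N := prime_gt0 (qprime i).
pose v i m := riesz_factor a (low_half (q i) (x%:Z + P.[m%:Z])).
pose u m := \prod_(i < j) v i m.
have perv i : periodic (q i) (v i).
  by move=> m c; congr riesz_factor; exact: low_half_poly_periodic.
have ME : M = \prod_(j <= i < n) riesz_factor a (low_half (q i) x%:Z).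
  by rewrite /M /riesz_prod /bits /mkseq -map_drop drop_iota add0n big_map.
have -> : avg (N j) x = (N j)%:R^-1 * \sum_(1 <= m < (N j).+1) u m * M.
  rewrite /avg -mulr_suml; congr (_ * _); rewrite mulr_suml.
  apply: eq_big_nat => m /andP[m1 mN].
  rewrite /riesz_fun -(big_mkord xpredT
    (fun i => riesz_factor a (low_half (q i) (x%:Z + P.[m%:Z])))).
  rewrite (@big_cat_nat _ _ _ j)//= big_mkord ME; congr (_ * _).
  apply: eq_big_nat => i /andP[ji ni]; congr riesz_factor.
  have [+ _] := tx i ni; apply; rewrite m1 (leq_trans _ (Nmono ji))//.
rewrite -mulr_suml mulrA -[X in nc (_ - X)]mul1r -mulrBl ncM.
set A := (N j)%:R^-1 * _.
have Qj0 := prodq_gt0 q0 j.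
have u2 m : nc (u m) <= 2.
  apply: (nc_prod_le (a := a) (n := n)) => //; first by rewrite card_ord.
  by move=> i; rewrite nc_riesz_factor.
have peru : periodic (prodq q j) u by apply: periodic_prod => i _; exact: perv.
have h1 := avg_periodic Qj0 (N0 j) peru u2.
set B := (prodq q j)%:R^-1 * _ in h1.
pose e i := (\sum_(m < q i) sign R (low_half (q i) (x%:Z + P.[(m : nat)%:Z]))) / (q i)%:R.
have BE : B = \prod_(i < j) Complex 1 (a * e i).
  rewrite /B sum_crt_prod// /prodq natr_prod -prodfV -big_split /=.
  apply: eq_bigr => i _; rewrite /v.
  by rewrite (@mean_riesz_factor a (q i) (fun m => low_half (q i) (x%:Z + P.[m%:Z]))).
have eB i : (i < j)%N -> `|e i| <= (64 * n%:R)^-1.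
  move=> ij; have [_ h] := tx i (leq_trans ij jn).
  by rewrite /e normrM [X in _ * X]ger0_norm ?invr_ge0// ler_pdivrMr ?ltr0n. 
have nR : 0 < n%:R :> R by rewrite ltr0n.
have tau1 : (64 * n%:R)^-1 <= 1 :> R.
  rewrite invf_le1 ?mulr_gt0//; have : 1 <= n%:R :> R by rewrite ler1n.
  lra.
have h2 : nc (B - 1) <= 2 * (n%:R * (a * (64 * n%:R)^-1)).
  rewrite BE; apply: le_trans (nc_prod_sub1 (z := fun i => Complex 1 (a * e i)) _) _.
    move=> k kj; apply: (nc_prod_le (a := a) (n := n)) => //.
      by rewrite card_ord (leq_trans kj).
    move=> i; rewrite nc_Complex1 lerD2l exprMn ler_piMr ?sqr_ge0//.
    rewrite -(@real_normK _ (e i)) ?num_real// exprn_ile1//.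
    by rewrite (le_trans (eB i _))// (leq_trans (ltn_ord i)).
  rewrite ler_pM2l//.
  apply: (@le_trans _ _ (\sum_(i < j) (a * (64 * n%:R)^-1))).
    apply: ler_sum => i _; rewrite nc_Complex1_sub1 normrM gtr0_norm//.
    by rewrite ler_pM2l// eB.
  rewrite sumr_const card_ord -[leLHS]mulr_natl ler_pM2r ?ler_nat//.
  by rewrite mulr_gt0// invr_gt0 mulr_gt0.
have {}h2 : nc (B - 1) <= a / 32.
  apply: (le_trans h2); rewrite le_eqVlt; apply/orP; left; apply/eqP.
  by field; rewrite gt_eqF.
have {}h1 : nc (A - B) <= a / 32.
  apply: (le_trans h1); have : (prodq q j)%:R / (N j)%:R <= a / 128 :> R.
    by rewrite ler_pdivrMr ?ltr0n.
  lra.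
have M2 : nc M <= 2.
  by apply: (nc_riesz_prod_le2 (n := n)) => //; rewrite size_drop size_mkseq leq_subr.
have : nc (A - 1) <= a / 16.
  have -> : A - 1 = (A - B) + (B - 1) by ring.
  by apply: (le_trans (ncD _ _)); lra.
move=> A1; apply: (@le_trans _ _ (a / 16 * 2)); last by lra.
by rewrite ler_pM ?nc_ge0.
Qed.

(** The limit products at s and t differ by a factor, the product over [s, t),
    which is far from 1 by [riesz_prod_sub1]. If S is not 0 then |S| >= 1, and the errors
    a/8 of [avg_close] absorb at most half of the gap a |S| / 2. Since
    y = a |S| / 4 is at most 1, its power r dominates its square. *)
Lemma avg_jump (r : R) (x s t : nat) : 0 < r -> r <= 2 -> (s <= t <= n)%N ->
  all_typical x ->
  let S := walk R (take (t - s) (drop s (bits x))) in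
  `|S| * a <= 2^-1 ->
  (a / 4) ^+ 2 * S ^+ 2 <= nc (avg (N t) x - avg (N s) x) `^ r.
Proof.
move=> r0 r2 /andP[st tn] tx S Sa.
have [->|S0] := eqVneq S 0; first by rewrite expr0n mulr0 powR_ge0.
have S1 : 1 <= `|S|.
  have [c [k [e [_ Sk _]]]] := riesz_prod_form a (take (t - s) (drop s (bits x))).
  move: S0; rewrite -normr_eq0 /S Sk pnatr_eq0 -lt0n => k0.
  by rewrite ler1n.
set D := nc _; pose y := a * `|S| / 4.
have y0 : 0 < y by rewrite /y !mulr_gt0// (lt_le_trans _ S1).
have y1 : y <= 1 by rewrite /y; lra.
have yD : y <= D.
  have c1 := avg_close tn tx; have c2 := avg_close (leq_trans st tn) tx.
  move: c1 c2; set Mt := riesz_prod a (drop t _); set Ms := riesz_prod a (drop s _) => c1 c2.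
  have MsE : Ms = riesz_prod a (take (t - s) (drop s (bits x))) * Mt.
    have -> : Mt = riesz_prod a (drop (t - s) (drop s (bits x))) by rewrite drop_drop subnK.
    by rewrite /riesz_prod -big_cat cat_take_drop.
  have h : `|S| * a / 2 <= nc (Ms - Mt).
    have -> : Ms - Mt = (riesz_prod a (take (t - s) (drop s (bits x))) - 1) * Mt.
      by rewrite MsE mulrBl mul1r.
    rewrite ncM; apply: (le_trans (riesz_prod_sub1 (ltW a0) Sa)).
    by rewrite ler_peMr ?nc_ge0// nc_riesz_prod_ge1.
  have : nc (Ms - Mt) <= D + a / 8 + a / 8.
    have -> : Ms - Mt = - (avg (N t) x - avg (N s) x) + (avg (N t) x - Mt)
      + (- (avg (N s) x - Ms)) by ring.
    rewrite (le_trans (ncD _ _))// lerD ?ncN//.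
    by rewrite (le_trans (ncD _ _))// lerD ?ncN.
  have : a <= a * `|S| by rewrite ler_peMr// ltW.
  rewrite /y; lra.
have -> : (a / 4) ^+ 2 * S ^+ 2 = y `^ 2%:R.
  have S2 : S ^+ 2 = `|S| ^+ 2 by rewrite real_normK ?num_real.
  by rewrite (powR_mulrn _ (ltW y0)) S2 /y; field.
apply: (@le_trans _ _ (y `^ r)).
  by apply: ger_powR => //; rewrite y0.
by apply: ge0_ler_powR; rewrite ?nnegrE ?nc_ge0 ?(ltW r0) ?(ltW y0).
Qed.

End Averages.

(** * Large variation on a cyclic group *)

Section LargeVariation.
Variable R : realType.
Local Notation nc := (@ComplexField.Normc.normc R).

Lemma path_sumE (w : nat -> nat -> R) s p :
  path_sum w s p = \sum_(0 <= j < size p) w (nth 0%N (s :: p) j) (nth 0%N (s :: p) j.+1).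
Proof.
elim: p s => [|t p IH] s; first by rewrite big_nil.
by rewrite /= big_nat_recl//= IH.
Qed.

Lemma path_sum_variation (I : set nat) (r V : R) (N : nat -> nat) (F : nat -> R[i]) p :
  0 <= r -> 0 <= V -> p != [::] -> path leq 0%N p ->
  (forall j, I (N j)) -> (forall i j, (i <= j)%N -> (N i <= N j)%N) ->
  V <= path_sum (fun i j => nc (F (N j) - F (N i)) `^ r) 0%N p ->
  ((V `^ r^-1)%:E <= Defs.variation I r F)%E.
Proof.
move=> r0 V0 p0 pp IN Nmono VS.
apply: (@le_trans _ _ ((path_sum (fun i j => nc (F (N j) - F (N i)) `^ r) 0%N p `^ r^-1)%:E)).
  by rewrite lee_fin ge0_ler_powR ?invr_ge0 ?nnegrE// (le_trans V0).
apply: ereal_sup_ubound; exists (size p), (fun j => N (nth 0%N (0%N :: p) j)); split.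
- by rewrite lt0n size_eq0.
- by move=> j _; exact: IN.
- by move=> j jp; apply: Nmono; move/pathP: pp => /(_ 0%N j jp).
- by rewrite path_sumE.
Qed.

Lemma bernoulli_ineq (x : R) n : 0 <= x <= 1 -> 1 - n%:R * x <= (1 - x) ^+ n.
Proof.
move=> /andP[x0 x1]; elim: n => [|n IH]; first by rewrite mul0r subr0.
rewrite exprS -natr1; have nx : 0 <= n%:R * x by rewrite mulr_ge0.
apply: (@le_trans _ _ ((1 - x) * (1 - n%:R * x))).
  have : 0 <= x * (n%:R * x) by rewrite mulr_ge0.
  lra.
by rewrite ler_wpM2l// subr_ge0.
Qed.

Lemma typical_periodic (P : {poly int}) (tau : R) (N q : nat) : prime q ->
  periodic q (fun x => `[< typical P tau N q x >]).
Proof.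
move=> pq x c; apply: asbool_equiv_eq; rewrite /typical.
have shift (z : int) : low_half q ((x + c * q)%N%:Z + z) = low_half q (x%:Z + z).
  by rewrite PoszD addrAC low_half_periodic.
have shift0 : low_half q (x + c * q)%N%:Z = low_half q x%:Z.
  by rewrite PoszD low_half_periodic.
rewrite shift0; under eq_bigr do rewrite shift.
by split=> -[h1 h2]; split=> // m /h1; rewrite shift.
Qed.

(** The number of signs is n = s^2, and a = 1 / (6 s) turns the bound 3 s on the
    increments into the bound 1/2 that [avg_jump] needs. Each square is then
    weighted by (a/4)^2, so that a partition with squares adding up to
    K^2 n / 2 yields K^2 / (32 * 36), which exceeds any given constant. *)
Lemma large_variation (I : set nat) (P : {poly int}) (r L : R) :
  (forall N, I N -> (1 <= N)%N) -> infinite_set I -> (1 < size P)%N ->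
  0 < r -> r <= 2 -> 0 <= L ->
  exists (Q : nat) (F : int -> R[i]), [/\ (0 < Q)%N,
    forall y, F (y + Q%:Z) = F y, forall y, nc (F y) <= 2 &
    Q%:R / 4 <= \sum_(x < Q) `[< (L%:E <= Defs.variation I r
      (fun M => (M%:R^-1 * \sum_(1 <= m < M.+1) F ((x : nat)%:Z + P.[m%:Z]))%R))%E >]%:R :> R].
Proof.
move=> I1 Iinf sP r0 r2 L0.
have [K K0 LK] : exists2 K : nat, (0 < K)%N & 36 * (32 * L `^ r) <= K%:R.
  have LP : 0 <= 36 * (32 * L `^ r) by rewrite !mulr_ge0 ?powR_ge0.
  have := archi_boundP LP; move: (Num.bound _) => K LK.
  by exists K.+1 => //; rewrite (le_trans (ltW LK))// ler_nat.
have hK : L <= (K%:R ^+ 2 / 32 / 36) `^ r^-1.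
  have {1}-> : L = (L `^ r) `^ r^-1 by rewrite -powRrM mulfV ?gt_eqF// powRr1.
  have K1 : 1 <= K%:R :> R by rewrite ler1n.
  have hL : L `^ r <= K%:R ^+ 2 / 32 / 36.
    have : K%:R <= K%:R ^+ 2 :> R by rewrite expr2 ler_peMr.
    by rewrite !ler_pdivlMr//; lra.
  by apply: ge0_ler_powR; rewrite ?nnegrE ?powR_ge0 ?invr_ge0 ?(ltW r0) ?(le_trans _ hL) ?powR_ge0.
have [s s0 hs] := @most_walks_split R K K0.
have sR : 0 < s%:R :> R by rewrite ltr0n.
set n := (s ^ 2)%N in hs; have n0 : (0 < n)%N by rewrite expn_gt0 s0.
have nR : 0 < n%:R :> R by rewrite ltr0n.
have nE : n%:R = s%:R ^+ 2 :> R by rewrite /n natrX.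
pose a : R := (6 * s%:R)^-1.
have a0 : 0 < a by rewrite invr_gt0 mulr_gt0.
have as1 : a * s%:R = 6^-1 by rewrite /a; field; rewrite gt_eqF.
have na : n%:R * a ^+ 2 = 36^-1 by rewrite nE mulrC -exprMn as1; field.
have a1 : a ^+ 2 <= 1.
  have : a ^+ 2 <= n%:R * a ^+ 2 by rewrite ler_peMl ?sqr_ge0// ler1n.
  by lra.
have an : (1 + a ^+ 2) ^+ n <= 4.
  have b1 : 1 - n%:R * a ^+ 2 <= (1 - a ^+ 2) ^+ n.
    by rewrite bernoulli_ineq// sqr_ge0.
  have b2 : (1 + a ^+ 2) ^+ n * (1 - a ^+ 2) ^+ n <= 1.
    rewrite -exprMn exprn_ile1//.
      by rewrite mulr_ge0 ?subr_ge0// addr_ge0// sqr_ge0.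
    by have := sqr_ge0 (a ^+ 2); lra.
  have b3 : 0 <= (1 + a ^+ 2) ^+ n by rewrite exprn_ge0// addr_ge0// sqr_ge0.
  rewrite na in b1; nra.
pose delta : R := (2 * n%:R)^-1; pose tau : R := (64 * n%:R)^-1.
have delta0 : 0 < delta by rewrite invr_gt0 mulr_gt0.
have delta1 : delta <= 1.
  rewrite invf_le1 ?mulr_gt0//; have : 1 <= n%:R :> R by rewrite ler1n.
  by lra.
have tau0 : 0 < tau by rewrite invr_gt0 mulr_gt0.
have hgood N := most_typical N sP tau0 delta0.
have [] := @sparse_times R I (a / 128) (fun N q => forall b : bool,
    (1 - delta) * (q%:R / 2) <=
    \sum_(x < q) `[< typical P tau N q x /\ low_half q (x : nat)%:Z = b >]%:R) Iinf.
- by rewrite divr_gt0.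
- by move=> N; have [B hB] := hgood N; exists B => q pq Bq; apply: hB.
move=> N [q [IN Nmono qP qco qN]].
have qprime i : prime (q i) by have [] := qP i.
have q0 i : (0 < q i)%N := prime_gt0 (qprime i).
have N0 i : (0 < N i)%N := I1 _ (IN i).
exists (prodq q n), (riesz_fun a n q); split.
- exact: prodq_gt0.
- move=> y; apply: eq_bigr => i _; congr riesz_factor.
  have /dvdnP[d ->] : (q i %| prodq q n)%N by rewrite /prodq (bigD1 i)//= dvdn_mulr.
  by rewrite low_half_periodic.
- move=> y; apply: (nc_prod_le (a := a) (n := n)) => //; first by rewrite card_ord.
  by move=> i; rewrite nc_riesz_factor.
have := @joint_law R q q0 qco delta n (fun i x => `[< typical P tau (N i) (q i) x >])
  (fun i x => low_half (q i) x%:Z) (fun u => `[< splits_well R K s u >]%:R).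
rewrite (ltW delta0) delta1 => /(_ isT) joint.
have {joint} := joint (fun u => ler0n _ _) (fun i => typical_periodic P tau (N i) (qprime i)).
move=> /(_ _ _)/wrap[].
  by move=> i x c; rewrite PoszD low_half_periodic.
  move=> i b; have [_ /(_ b) h] := qP i; apply: (le_trans h).
  apply: ler_sum => x _; rewrite asbool_and; case: asboolP => // _.
  by case: asboolP => [->|]; rewrite ?eqxx.
move=> hj.
have {}hj : (prodq q n)%:R / 4 <= \sum_(x < prodq q n)
    `[< splits_well R K s (mkseq (fun i => low_half (q i) (x : nat)%:Z) n) >]%:R *
     \prod_(i < n) `[< typical P tau (N i) (q i) x >]%:R :> R.
  apply: le_trans hj.
  have b1 : 2^-1 <= (1 - delta) ^+ n.
    apply: le_trans (bernoulli_ineq _ _); last by rewrite ltW.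
    have -> : n%:R * delta = 2^-1 by rewrite /delta; field; rewrite gt_eqF.
    by lra.
  have Q0 : 0 <= (prodq q n)%:R :> R by [].
  have : 2^-1 * (prodq q n)%:R <= (1 - delta) ^+ n * (prodq q n)%:R by rewrite ler_wpM2r.
  move=> h; apply: (@le_trans _ _ (2^-1 * (prodq q n)%:R * 2^-1)); first by lra.
  by rewrite ler_pM// mulr_ge0.
apply: (le_trans hj); apply: ler_sum => x _.
case: asboolP => [sw|_]; last by rewrite mul0r.
have [tx|] := boolP [forall i : 'I_n, `[< typical P tau (N i) (q i) x >]]; last first.
  move=> /forallPn[i hi]; rewrite (bigD1 i)//= (negPf hi) mul0r mulr0.
  by rewrite ler0n.
rewrite big1 ?mulr1; last by move=> i _; move/forallP: tx => /(_ i) ->.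
case: asboolP => // bad; exfalso; apply: bad.
have allt : all_typical R P n N q x.
  by move=> i ni; move/forallP: tx => /(_ (Ordinal ni)) /asboolP.
have := sw ((a / 4) ^+ 2) (fun i j => nc (avg P a n q (N j) x - avg P a n q (N i) x) `^ r).
rewrite size_mkseq => /(_ (sqr_ge0 _) (fun i j => powR_ge0 _ _)) h.
have {h} [i j ijn Ss|p [pp lp hp]] := h.
  apply: avg_jump => //.
  have : `|walk R (take (j - i) (drop i (bits n q x)))| * a <= 3 * s%:R * a.
    by rewrite ler_pM2r.
  by move=> h; apply: (le_trans h); rewrite -mulrA [s%:R * a]mulrC as1; lra.
rewrite (_ : (a / 4) ^+ 2 * _ * _ = K%:R ^+ 2 / 32 / 36) in hp; last first.
  transitivity (K%:R ^+ 2 / 32 * (n%:R * a ^+ 2)); first by field.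
  by rewrite na; field.
apply: (@le_trans _ _ ((K%:R ^+ 2 / 32 / 36) `^ r^-1)%:E); first by rewrite lee_fin.
apply: (@path_sum_variation I r _ N _ p) => //; first exact: ltW.
by apply/eqP => pE; move: lp n0; rewrite pE /= => <-.
Qed.

End LargeVariation.

(** * Rotations of finite cycles and norms *)

Definition cyc (n : nat) : Type := 'I_n.+1.
HB.instance Definition _ n := Choice.on (cyc n).
HB.instance Definition _ n := isPointed.Build (cyc n) ord0.
HB.instance Definition _ n := @isMeasurable.Build default_measure_display
  (cyc n) discrete_measurable discrete_measurable0
  discrete_measurableC discrete_measurableU.

Section UniformCycle.
Variables (R : realType) (n : nat).

Definition unif : set (cyc n) -> \bar R :=
  mscale (n.+1%:R^-1)%:nng (msum (fun i => dirac (inord i : cyc n)) n.+1).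
HB.instance Definition _ := Measure.on unif.

Definition rot (x : cyc n) : cyc n := ((x : 'I_n.+1) + inZp 1)%R.
Definition unrot (x : cyc n) : cyc n := ((x : 'I_n.+1) - inZp 1)%R.

Lemma unifE (A : set (cyc n)) :
  unif A = ((\sum_(x < n.+1) (x \in A)%:R) / n.+1%:R)%:E.
Proof.
rewrite /unif /mscale /msum /= mulrC EFinM -sumEFin; congr (_ * _)%E.
  by apply: eq_bigr => i _; rewrite -[in RHS](inord_val i); exact: diracE.
Qed.

Lemma unif_ge (c : R) (A : set (cyc n)) (b : 'I_n.+1 -> bool) :
  (forall x, b x -> A x) -> c * n.+1%:R <= \sum_x (b x)%:R ->
  (c%:E <= unif A)%E.
Proof.
move=> bA cb; rewrite unifE lee_fin ler_pdivlMr ?ltr0n//; apply: (le_trans cb).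
apply: ler_sum => x _; rewrite ler_nat.
by case bx: (b x) => //; rewrite mem_set//; exact: bA.
Qed.

Lemma unif_setT : unif setT = 1%E.
Proof.
rewrite unifE (eq_bigr (fun=> 1)) => [|i _]; last by rewrite in_setT.
by rewrite sumr_const card_ord divff// pnatr_eq0.
Qed.

HB.instance Definition _ := Measure_isProbability.Build _ _ _ unif unif_setT.

Lemma rotK : cancel rot unrot. Proof. by move=> x; exact: addrK. Qed.
Lemma unrotK : cancel unrot rot. Proof. by move=> x; exact: subrK. Qed.

Lemma mp_system_rot : mp_system unif rot unrot.
Proof.
split=> //; [exact: rotK|exact: unrotK|].
move=> E _; suff : unif (rot @` E) = unif E by []. rewrite !unifE; congr ((_ / _)%:E).
rewrite (reindex_inj (can_inj rotK)) /=; apply: eq_bigr => x _; congr (_%:R).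
congr nat_of_bool; apply/idP/idP; rewrite !inE; first by move=> [y Ey /(can_inj rotK) <-].
by move=> Ex; exists x.
Qed.

Variable (C : Type) (F : int -> C).
Hypothesis FQ : forall y, F (y + n.+1%:Z) = F y.

Lemma periodicZ (z : int) (c : nat) : F (z + (c * n.+1)%N%:Z) = F z.
Proof.
elim: c => [|c IH]; first by rewrite mul0n addr0.
by rewrite mulSn addnC PoszD addrA FQ.
Qed.

Lemma periodic_modn (z : int) (m : nat) : F (z + (m %% n.+1)%N%:Z) = F (z + m%:Z).
Proof.
by rewrite [in RHS](divn_eq m n.+1) addnC PoszD addrA periodicZ.
Qed.

Lemma periodic_rot (z : int) (x : cyc n) :
  F (z + (rot x : 'I_n.+1)%:Z) = F (z + (x : 'I_n.+1)%:Z + 1).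
Proof. by rewrite /= modnDmr periodic_modn PoszD addrA. Qed.

Lemma periodic_unrot (z : int) (x : cyc n) :
  F (z + (unrot x : 'I_n.+1)%:Z) = F (z + (x : 'I_n.+1)%:Z - 1).
Proof.
rewrite -[in RHS](unrotK x) addrAC periodic_rot; congr F; ring.
Qed.

(** Lets orbits in the cycle be computed in the integers, for negative times
    also. *)
Lemma periodic_iterz (m : int) (x : cyc n) :
  F ((iterz rot unrot m x : 'I_n.+1)%:Z) = F ((x : 'I_n.+1)%:Z + m).
Proof.
suff gen z : F (z + (iterz rot unrot m x : 'I_n.+1)%:Z) = F (z + (x : 'I_n.+1)%:Z + m).
  by have := gen 0; rewrite !add0r.
have mS (k : nat) : k.+1%:Z = k%:Z + 1 by rewrite -addn1 PoszD.
case: m => m.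
  elim: m z => [|m IH] z; first by rewrite addr0.
  rewrite [iterz _ _ _ _]/(rot (iterz rot unrot m x)) periodic_rot addrAC IH.
  by congr F; rewrite mS; ring.
have negE k : Negz k = - k%:Z - 1 by rewrite NegzE mS opprD.
elim: m z => [|m IH] z.
  by rewrite [iterz _ _ _ _]/(unrot x) periodic_unrot; congr F; rewrite negE; ring.
rewrite [iterz _ _ _ _]/(unrot (iterz rot unrot (Negz m) x)) periodic_unrot addrAC IH.
by congr F; rewrite !negE mS; ring.
Qed.

End UniformCycle.

Section LpBounds.
Variable R : realType.

Lemma Lnorm_le d (X : measurableType d) (mu : {measure set X -> \bar R})
    (p : \bar R) (f : X -> \bar R) (c : R) :
  mu setT = 1%E -> (0 < p)%E -> 0 <= c -> measurable_fun setT f -> (forall x, `|f x| <= c%:E)%E ->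
  (Lnorm mu p f <= c%:E)%E.
Proof.
move=> mu1 p0 c0 mf fc; rewrite unlock; case: p p0 => [p|_|//].
- rewrite lte_fin => p0.
  have -> : c%:E = ((c `^ p)%:E `^ p^-1)%E.
    by rewrite poweR_EFin -powRrM mulfV ?gt_eqF// powRr1.
  have I0 : (0 <= \int[mu]_x (`|f x| `^ p))%E.
    by apply: integral_ge0 => x _; exact: poweR_ge0.
  apply: gt0_ler_poweR; rewrite ?invr_ge0 ?(ltW p0)//.
  - by rewrite in_itv /= I0 leey.
  - by rewrite in_itv /= leey lee_fin powR_ge0.
  have -> : (c `^ p)%:E = (\int[mu]_(x in setT) (cst (c `^ p)%:E) x)%E.
    by rewrite integral_cst// mu1 mule1.
  apply: ge0_le_integral => //.
  - by move=> x _; exact: poweR_ge0.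
  - apply: (@measurableT_comp _ _ _ _ _ _ (fun x => x `^ p)%E) => //=.
      exact: measurable_poweR.
    exact: measurableT_comp.
  - move=> x _ /=; rewrite -poweR_EFin; apply: gt0_ler_poweR; rewrite ?(ltW p0)//.
      by rewrite in_itv /= abse_ge0 leey.
    by rewrite in_itv /= leey lee_fin c0.
- case: ifP => _; last by rewrite lee_fin.
  by apply/ess_supP; apply: nearW => x; exact: fc.
Qed.

(** The constant is m^(1/p), and 1 for p = oo, where all that matters is that G
    is not negligible. What counts is that it does not depend on the space. *)
Lemma Lnorm_ge (p : \bar R) (m : R) : (0 < p)%E -> 0 < m ->
  exists2 k : R, 0 < k &
  forall d (X : measurableType d) (mu : {measure set X -> \bar R})
    (f : X -> \bar R) (G : set X) (c : R),
    mu setT = 1%E -> measurable_fun setT f -> measurable G -> (m%:E <= mu G)%E -> 0 <= c ->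
    (forall x, G x -> (c%:E <= f x)%E) -> ((c * k)%:E <= Lnorm mu p f)%E.
Proof.
case: p => [p|_|//]; last first.
  move=> m0; exists 1 => // d X mu f G c mu1 mf mG muG c0 fG; rewrite mulr1 unlock.
  rewrite mu1 lte01.
  rewrite leNgt; apply/negP => hlt.
  have /ess_supP ae := lexx (ess_sup mu (abse \o f)).
  have neg : mu.-negligible G.
    apply: negligibleS ae => x Gx /= hx; have := lt_le_trans hlt (fG x Gx).
    by move=> /lt_le_trans /(_ (lee_abs _)); rewrite ltNge hx.
  by move: muG; rewrite (measure_negligible mG neg) lee_fin leNgt m0.
rewrite lte_fin => p0 m0; exists (m `^ p^-1); first exact: powR_gt0.
move=> d X mu f G c mu1 mf mG muG c0 fG; rewrite unlock.
have -> : (c * m `^ p^-1)%:E = ((c `^ p * m)%:E `^ p^-1)%E.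
  by rewrite poweR_EFin powRM ?powR_ge0 ?ltW// -powRrM mulfV ?gt_eqF// powRr1.
have I0 : (0 <= \int[mu]_x (`|f x| `^ p))%E.
  by apply: integral_ge0 => x _; exact: poweR_ge0.
apply: gt0_ler_poweR; rewrite ?invr_ge0 ?(ltW p0)//.
- by rewrite in_itv /= leey lee_fin mulr_ge0 ?powR_ge0 ?(ltW m0).
- by rewrite in_itv /= I0 leey.
apply: (@le_trans _ _ ((c `^ p)%:E * mu G)%E).
  by rewrite EFinM lee_wpmul2l// lee_fin powR_ge0.
rewrite -(integral_cst mu mG).
have mfp : measurable_fun setT (fun x => `|f x| `^ p)%E.
  apply: (@measurableT_comp _ _ _ _ _ _ (fun x => x `^ p)%E) => //=.
    exact: measurable_poweR.
  exact: measurableT_comp.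
apply: (@le_trans _ _ (\int[mu]_(x in G) (`|f x| `^ p))%E).
  apply: ge0_le_integral => //.
  - by move=> x _; rewrite lee_fin powR_ge0.
  - exact: measurable_funTS.
  - move=> x Gx /=; rewrite -poweR_EFin; apply: gt0_ler_poweR; rewrite ?(ltW p0)//.
    + by rewrite in_itv /= leey lee_fin c0.
    + by rewrite in_itv /= abse_ge0 leey.
    + by rewrite (le_trans (fG _ Gx))// lee_abs.
by apply: ge0_subset_integral => // x _; exact: poweR_ge0.
Qed.
End LpBounds.

(** * Failure of the variational estimate *)

Theorem corollary12p4 (R : realType) (k : nat) (hk : (1 <= k)%N)
    (P : 'I_k -> {poly int})
    (hP : ~ (forall i : 'I_k, exists c : int, P i = c%:P))
    (ps : 'I_k -> \bar R) (hps : forall i : 'I_k, (0 < ps i)%E)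
    (p : \bar R) (hp : (0 < p)%E)
    (r : R) (hr0 : 0 < r) (hr2 : r <= 2)
    (I : set nat) (hIpos : forall N : nat, I N -> (1 <= N)%N)
    (hIinf : infinite_set I) :
  ~ exists C : R, 0 < C /\
      forall (d : measure_display) (X : measurableType d)
        (mu : probability X R) (T S : X -> X),
        mp_system mu T S ->
        forall f : 'I_k -> X -> R[i],
          (forall i : 'I_k, in_cLp mu (ps i) (f i)) ->
          (LpVr mu p r I (poly_average T S P f)
             <= C%:E * \prod_(i < k) cLnorm mu (ps i) (f i))%E.
Proof.
move=> [C [C0 hC]].
have [i0 sP] : exists i, (1 < size (P i))%N.
  apply: contrapT => hn; apply: hP => i; exists (P i)`_0; apply: size1_polyC.
  by rewrite leqNgt; apply/negP => si; apply: hn; exists i.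
have m0 : 0 < 4^-1 :> R by rewrite invr_gt0.
have [c c0 hc] := Lnorm_ge hp m0.
pose L := C * 2 ^+ k / c + 1.
have L0 : 0 <= L by rewrite addr_ge0// divr_ge0 ?mulr_ge0 ?exprn_ge0// ltW.
have [Q [F [Q0 FQ F2 hQ]]] := large_variation hIpos hIinf sP hr0 hr2 L0.
case: Q Q0 FQ hQ => // n _ FQ hQ.
pose X : measurableType _ := cyc n; pose T := @rot n; pose S := @unrot n.
(* All the functions but one are constant, and all are bounded by 2, so that
   the right-hand side of the estimate is at most C * 2 ^ k. *)
pose f (i : 'I_k) (x : X) : R[i] := if i == i0 then F (x : 'I_n.+1)%:Z else 1.
have f2 i x : ComplexField.Normc.normc (f i x) <= 2.
  by rewrite /f; case: ifP => _; rewrite ?F2// ComplexField.Normc.normc1 ler1n.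
pose mu : probability (cyc n) R := @unif R n.
have mu1 : (mu : {measure set X -> \bar R}) setT = 1%E := unif_setT R n.
have norm2 i : (cLnorm mu (ps i) (f i) <= 2%:E)%E.
  apply: Lnorm_le => // x; rewrite lee_fin ger0_norm; first exact: f2.
  exact: nc_ge0.
have := hC _ X mu T S (mp_system_rot R n) f.
move=> /(_ _)/wrap[].
  by move=> i; split=> //; apply: le_lt_trans (norm2 i) _; exact: ltry.
apply/negP; rewrite -ltNge.
have prod2 : (\prod_(i < k) cLnorm mu (ps i) (f i) <= (2 ^+ k)%:E)%E.
  have : (0 <= \prod_(i < k) cLnorm mu (ps i) (f i) <= (\prod_(i < k) 2)%:E)%E.
    apply: (big_ind2 (fun x y => (0 <= x <= y%:E)%E)).
    - by rewrite lee_fin ler01 lexx.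
    - move=> x y x' y' /andP[x0 xy] /andP[x0' xy'].
      by rewrite mule_ge0//= EFinM lee_pmul.
    - by move=> i _; rewrite norm2 andbT; exact: Lnorm_ge0.
  by rewrite prodr_const card_ord => /andP[].
have ub : (C%:E * \prod_(i < k) cLnorm mu (ps i) (f i) <= (C * 2 ^+ k)%:E)%E.
  by rewrite EFinM lee_wpmul2l// lee_fin ltW.
apply: (le_lt_trans ub).
apply: (@lt_le_trans _ _ (L * c)%:E).
  by rewrite lte_fin /L mulrDl mul1r divfK ?gt_eqF// ltrDl.
pose G : set X := [set x : X | (L%:E <= Defs.variation I r
  (fun N => poly_average T S P f N x))%E].
apply: (hc _ _ _ _ G) => //.
apply: (unif_ge (b := fun x => `[< _ >])); last by rewrite mulrC; exact: hQ.
move=> x /asboolP hx; rewrite /G /=.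
have -> : (fun N => poly_average T S P f N x) =
  (fun N => N%:R^-1 * \sum_(1 <= m < N.+1) F ((x : nat)%:Z + (P i0).[m%:Z])); last exact: hx.
apply/funext => N; congr (_ * _); apply: eq_bigr => m _.
rewrite (bigD1 i0)//= big1 ?mulr1; last by move=> i /negPf ii; rewrite /f ii.
by rewrite /f eqxx (periodic_iterz FQ).
Qed.
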